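(* Fix $T\in(0,\infty)$ and $\beta$ with $1<\beta\le 2$. Let $(a_{i,j})_{i,j\ge1}$, $(p_{i,j})_{i,j\ge 1}$ be real numbers such that, for some constant $A>0$, $$0\le a_{i,j}=a_{j,i}\le A(i+j),\qquad 0\le p_{i,j}=p_{j,i}\le 1\qquad\text{for all } i,j\ge1 .$$ Let $N_{i,j}^s$ ($i,j\ge1$, $1\le s\le i+j-1$) be real numbers with $$N_{i,j}^s=N_{j,i}^s\ge0,\qquad \sum_{s=1}^{i+j-1}s\,N_{i,j}^s=i+j\qquad\text{for all } i,j\ge 1,$$ and assume there is a constant $\alpha_0$ such that $N_{i,j}^s\le\alpha_0$ for all $i,j\ge1$ and $s=1,\dots,i+j-1$. Let $w^0=(w_i^0)_{i\in\mathbb N}$ satisfy $w_i^0\ge0$ for all $i$ and $\sum_{i=1}^\infty i^\beta w_i^0<\infty$ (that is, $w^0\in\Omega_\beta^+(0)$). Then there exists a mass-conserving classical solution $w=(w_i)_{i\in\mathbb N}\in\Omega_\beta^+(T)$ on $[0,T]$ to the discrete coagulation equations with collisional breakage with initial datum $w^0$. If in addition there are constants $B>0$ and $\gamma\in[0,1]$ with $1<1+\gamma\le\beta$ such that $0\le a_{i,j}=a_{j,i}\le B(i^\gamma+j^\gamma)$ for all $i,j\ge1$, then the classical solution with initial datum $w^0$ is unique in $\Omega_\beta^+(T)$.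
   Context: Here $\mathbb N=\{1,2,\dots\}$. The discrete coagulation equations with collisional breakage with initial datum $w^0$ are, for all $i\in\mathbb N$, $$\frac{dw_i}{dt}=\frac12\sum_{j=1}^{i-1}p_{j,i-j}a_{j,i-j}w_jw_{i-j}-\sum_{j=1}^\infty a_{i,j}w_iw_j+\frac12\sum_{j=i+1}^\infty\sum_{k=1}^{j-1}N_{j-k,k}^i(1-p_{j-k,k})a_{j-k,k}w_{j-k}w_k,\qquad w_i(0)=w_i^0 .$$ Let $l_1^\beta$ be the Banach space of real sequences $(y_i)_{i\in\mathbb N}$ with $\sum_{i=1}^\infty i^\beta|y_i|<\infty$. For $T\geq 0$, $\Omega_\beta(T)$ is the space of $w=(w_i)_{i\in\mathbb N}\in\mathcal C([0,T],l_1^\beta)$ with norm $\|w\|=\sup_{t\in[0,T]}\sum_{i=1}^\infty i^\beta|w_i(t)|$, and $\Omega_\beta^+(T)=\{w\in\Omega_\beta(T): w_i\ge0\text{ for each } i\ge1\}$. A classical solution on $[0,T]$ is $w=(w_i)_{i\in\mathbb N}\in\Omega_\beta^+(T)$ such that each $w_i$ is continuously differentiable on $[0,T]$ and the differential equations $$\frac{dw_i}{dt}(t)=\frac12\sum_{j=1}^{i-1}p_{j,i-j}a_{j,i-j}w_j(t)w_{i-j}(t)-\sum_{j=1}^\infty a_{i,j}w_i(t)w_j(t)+\frac12\sum_{j=i+1}^\infty\sum_{k=1}^{j-1}N_{j-k,k}^i(1-p_{j-k,k})a_{j-k,k}w_{j-k}(t)w_k(t)$$ hold for all $i\in\mathbb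 N$ and all $t\in[0,T]$ (one-sided derivatives at the endpoints), together with the initial condition $w_i(0)=w_i^0$ for all $i\in\mathbb N$. It is mass conserving if $\mathcal M_1(t):=\sum_{i=1}^\infty i\,w_i(t)$ satisfies $\mathcal M_1(t)=\mathcal M_1(0)$ for all $t\in[0,T]$. *)

(* Defs.v *)
From Stdlib Require Import Reals.
From Coquelicot Require Import Coquelicot.
Open Scope R_scope.

(* Sequences indexed by {1, 2, ...} are functions on nat whose value at 0 is
   never used: every sum starts at an index >= 1 and every quantified index is
   assumed to be >= 1. *)

(* sum_from m f is the sum of f j over j >= m.  Since [Series] is total, it is
   meaningful only together with summable_from m f. *)
Definition summable_from (m : nat) (f : nat -> R) : Prop :=
  ex_series (fun n => f (m + n)%nat).
Definition sum_from (m : nat) (f : nat -> R) : R :=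
  Series (fun n => f (m + n)%nat).

Definition in_l1 (beta : R) (y : nat -> R) : Prop :=
  summable_from 1 (fun i => Rpower (INR i) beta * Rabs (y i)).
Definition norm_l1 (beta : R) (y : nat -> R) : R :=
  sum_from 1 (fun i => Rpower (INR i) beta * Rabs (y i)).

Definition segment (T t : R) : Prop := 0 <= t <= T.

(* A path w is a function of time, with w t i standing for w_i(t); only its
   values on [0,T] matter. *)
Definition Omega (beta T : R) (w : R -> nat -> R) : Prop :=
  (forall t, segment T t -> in_l1 beta (w t)) /\
  (forall t, segment T t ->
     filterlim (fun s => norm_l1 beta (fun i => w s i - w t i))
       (within (segment T) (locally t)) (locally 0)).

Definition Omega_plus (beta T : R) (w : R -> nat -> R) : Prop :=
  Omega beta T w /\
  (forall i t, (1 <= i)%nat -> segment T t -> 0 <= w t i).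

(* Here N i j s stands for N_{i,j}^s.  The finite sums [sum_n_m f 1 n] are over
   1 <= k <= n, and vanish when n = 0; natural number subtraction is never
   truncated below. *)

Definition coag_gain (a p : nat -> nat -> R) (y : nat -> R) (i : nat) : R :=
  sum_n_m (fun j => p j (i - j)%nat * a j (i - j)%nat * y j * y (i - j)%nat)
    1 (i - 1).

Definition loss_term (a : nat -> nat -> R) (y : nat -> R) (i j : nat) : R :=
  a i j * y i * y j.

Definition breakage_term (a p : nat -> nat -> R) (N : nat -> nat -> nat -> R)
    (y : nat -> R) (i j : nat) : R :=
  sum_n_m (fun k => N (j - k)%nat k i * (1 - p (j - k)%nat k)
                    * a (j - k)%nat k * y (j - k)%nat * y k)
    1 (j - 1).

Definition cb_rhs (a p : nat -> nat -> R) (N : nat -> nat -> nat -> R)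
    (y : nat -> R) (i : nat) : R :=
  / 2 * coag_gain a p y i
  - sum_from 1 (loss_term a y i)
  + / 2 * sum_from (i + 1) (breakage_term a p N y i).

(* [D_in f d D t] says that d t is the derivative at t of f restricted to D,
   hence one-sided at the endpoints of [0,T]. *)
Definition classical_solution (beta T : R) (a p : nat -> nat -> R)
    (N : nat -> nat -> nat -> R) (w0 : nat -> R) (w : R -> nat -> R) : Prop :=
  Omega_plus beta T w /\
  (exists dw : R -> nat -> R,
     forall i, (1 <= i)%nat ->
       continuous_on (segment T) (fun t => dw t i) /\
       forall t, segment T t ->
         D_in (fun s => w s i) (fun s => dw s i) (segment T) t /\
         summable_from 1 (loss_term a (w t) i) /\
         summable_from (i + 1) (breakage_term a p N (w t) i) /\
         dw t i = cb_rhs a p N (w t) i) /\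
  (forall i, (1 <= i)%nat -> w 0 i = w0 i).

Definition M1 (w : R -> nat -> R) (t : R) : R :=
  sum_from 1 (fun i => INR i * w t i).

Definition mass_conserving (T : R) (w : R -> nat -> R) : Prop :=
  forall t, segment T t ->
    summable_from 1 (fun i => INR i * w t i) /\ M1 w t = M1 w 0.

(* Main.v *)
Require Import Defs.
From Stdlib Require Import Reals ZArith Lra Lia Psatz ClassicalEpsilon.
From Coquelicot Require Import Coquelicot.
From mathcomp Require filter.
Open Scope R_scope.

(** Coagulation and breakage are treated together. A collision of clusters of
sizes j and k has a rate a(j,k) and an outcome, the mean numbers nu(i,j,k) of
clusters of size i that leave it. Coagulation is the outcome concentrated on
j + k, so the equations take the single form
   w_i' = F_i(w) = sum over j, k of a(j,k)/2 (nu(i,j,k) - [i=j] - [i=k]) w_j w_k,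
with bounded nu >= 0 that preserves mass. Since a(j,k) <= 2 A j k, each F_i is a
bounded quadratic map for the first moment ([production_lipschitz]), and testing
finitely many equations against a weight g exchanges sums freely ([weak_form]).

Existence. Keep only the collisions with j + k <= n and run the explicit Euler
scheme with a step small enough to preserve positivity. Mass is conserved
exactly. If g(i)/i is nondecreasing, breaking clusters up never raises the
g-moment above what merging them would give, and if g(i)/i^3 is nonincreasing,
merging gives
   (j+k) (g(j+k) - g(j) - g(k)) <= 14 (g(j) k + j g(k))
([moderate_increment]). So every g-moment grows at most like exp(14 A M t), with
M the conserved mass, a rate common to all such g, all n and all steps
([euler_moderate]). Applied to g(i) = i^beta min(1, i/m), which is i^beta beyond m
and whose initial moment tends to 0 as m grows, this bounds the tails of the
beta-moment uniformly in time and in n. The schemes are also uniformly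
Lipschitz in time, so each satisfies a first-order expansion with an error that
is uniform in n. Along an ultrafilter all components converge at all times; the
uniform tails make the convergence strong for the first moment, and the
expansions, the conservation of mass and the tail bounds pass to the limit
([existence]). The tail bounds give continuity in time for the beta-norm.

Uniqueness. For two solutions u, v put e = u - v and s = u + v. In the weak form
with weight i sign(e_i), the collision (j,k) contributes at most
a(j,k)/2 ((j+k) - j + k) |e_j| s_k = k a(j,k) |e_j| s_k: the dangerous term j a(j,k)
cancels. As k a(j,k) <= 2 B j k^beta when a(j,k) <= B (j^gamma + k^gamma) and
1 + gamma <= beta, the quantity E = sum of i |e_i| satisfies a linear differential
inequality up to the tails of the beta-moment, which are small uniformly on
[0,T] because solutions are continuous in the beta-norm. Gronwall's argument
gives E = 0 ([uniqueness]). *)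

(** * Limits along an ultrafilter *)

(** This replaces the extraction of a diagonal subsequence: one ultrafilter makes
all components converge at all times simultaneously. The limit of u is the
supremum of the x that lie below U-almost all u n. *)
Lemma bounded_limits_along_ultrafilter :
  exists U : (nat -> Prop) -> Prop,
    ProperFilter U /\ (forall P, eventually P -> U P) /\
    forall (u : nat -> R) (M : R), (forall n, Rabs (u n) <= M) ->
      exists l, filterlim u U (locally l).
Proof.
  assert (HE : filter.ProperFilter (T := nat) eventually).
  { split; [intros [n Hn]; exact (Hn n (Nat.le_refl n)) |].
    split.
    - exists O; intros; exact Logic.I.
    - intros P Q HP HQ. exact (filter_and P Q HP HQ).
    - intros P Q HPQ HP. exact (filter_imp P Q HPQ HP). }
  destruct (filter.ultraFilterLemma HE) as [U [HU HEU]].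
  destruct (@filter.ultra_proper _ _ HU) as [Hne HF].
  assert (imp : forall P Q : nat -> Prop, (forall n, P n -> Q n) -> U P -> U Q).
  { intros P Q HPQ HP. exact (filter.filterS (P := P) (Q := Q) HPQ HP). }
  assert (and : forall P Q : nat -> Prop, U P -> U Q -> U (fun n => P n /\ Q n)).
  { intros P Q HP HQ. exact (filter.filterI HP HQ). }
  assert (cpl : forall P : nat -> Prop, U P \/ U (fun n => ~ P n)).
  { intros P. exact (filter.in_ultra_setVsetC P HU). }
  assert (ne : ~ U (fun _ => False)) by exact Hne.
  exists U. split; [| split; [exact HEU |]].
  - constructor.
    + intros P HP. destruct (Classical_Prop.classic (exists x, P x)) as [H | H]; [exact H |].
      exfalso; apply ne. apply (imp P); [| exact HP]. intros n Hn; apply H; now exists n.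
    + split; [apply HEU; exists O; auto | exact and | exact imp].
  - intros u M HM.
    destruct (completeness (fun x => U (fun n => x <= u n))) as [l [Hub Hlub]].
    + exists M. intros x Hx. apply Rnot_lt_le; intros Hlt. apply ne.
      apply (imp _ _) with (2 := Hx). intros n Hn. specialize (HM n).
      assert (H := Rle_abs (u n)). lra.
    + exists (- M). apply HEU; exists O. intros n _. specialize (HM n).
      assert (H := Rcomplements.Rabs_maj2 (u n)). lra.
    + exists l. intros P [eps HP].
      assert (H1 : U (fun n => l - eps < u n)).
      { apply Classical_Prop.NNPP; intros Hn.
        assert (l <= l - eps); [| assert (h := cond_pos eps); lra].
        apply Hlub. intros x Hx. apply Rnot_lt_le; intros Hlt. apply Hn.
        apply (imp _ _) with (2 := Hx). intros n Hxn. lra. }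
      assert (H2 : U (fun n => u n < l + eps)).
      { destruct (cpl (fun n => u n < l + eps)) as [H | H]; [exact H | exfalso].
        assert (l + eps <= l); [| assert (h := cond_pos eps); lra].
        apply Hub. apply (imp _ _) with (2 := H). intros n Hxn. lra. }
      apply (imp _ _) with (2 := and _ _ H1 H2). intros n [Ha Hb]. apply HP.
      change (Rabs (u n - l) < eps). apply Rabs_def1; lra.
Qed.

(** * Series and double series *)

Lemma Rabs_minus_le (x z : R) : Rabs (x - z) <= Rabs x + Rabs z.
Proof. unfold Rminus. rewrite <- (Rabs_Ropp z). apply Rabs_triang. Qed.

Lemma INR_ge_1 (j : nat) : (1 <= j)%nat -> 1 <= INR j.
Proof. intros H. apply le_INR in H. exact H. Qed.

Lemma exp_nondecreasing (x z : R) : x <= z -> exp x <= exp z.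
Proof. intros [H | ->]; [left; now apply exp_increasing | lra]. Qed.

Lemma sum_scal_l (c : R) (x : nat -> R) (n : nat) :
  sum_f_R0 (fun i => c * x i) n = c * sum_f_R0 x n.
Proof. rewrite scal_sum. apply sum_eq. intros; ring. Qed.

Lemma sum_extend (x : nat -> R) (m n : nat) :
  (m <= n)%nat -> (forall i, (m < i)%nat -> x i = 0) -> sum_f_R0 x n = sum_f_R0 x m.
Proof.
  intros Hmn H. induction Hmn as [| n Hmn IH]; [reflexivity |].
  rewrite tech5, IH, H by lia. ring.
Qed.

Lemma is_series_lim (x : nat -> R) :
  ex_series x -> is_lim_seq (sum_f_R0 x) (Series x).
Proof.
  intros Hs. apply Series_correct in Hs.
  apply is_lim_seq_ext with (sum_n x); [intros n; apply sum_n_Reals | exact Hs].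
Qed.

Lemma Series_nonneg (x : nat -> R) :
  (forall j, 0 <= x j) -> ex_series x -> 0 <= Series x.
Proof.
  intros Hx Hs.
  refine (is_lim_seq_le (fun _ => 0) _ _ _ _ (is_lim_seq_const 0) (is_series_lim x Hs)).
  intros n. now apply cond_pos_sum.
Qed.

Lemma Series_partial_le (x : nat -> R) (n : nat) :
  (forall j, 0 <= x j) -> ex_series x -> sum_f_R0 x n <= Series x.
Proof.
  intros Hx Hs. rewrite (Series_incr_n x (S n)); [| lia | exact Hs]. simpl Init.Nat.pred.
  assert (0 <= Series (fun k => x (S n + k)%nat)); [| lra].
  apply Series_nonneg; [intros; apply Hx |].
  now apply (ex_series_incr_n x (S n)).
Qed.

Lemma Series_le_bound (x : nat -> R) (C : R) :
  ex_series x -> (forall n, sum_f_R0 x n <= C) -> Series x <= C.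
Proof.
  intros Hs HC.
  assert (H := is_lim_seq_le _ _ _ _ HC (is_series_lim x Hs) (is_lim_seq_const C)). exact H.
Qed.

Lemma ex_series_bounded (x : nat -> R) (C : R) :
  (forall j, 0 <= x j) -> (forall n, sum_f_R0 x n <= C) -> ex_series x.
Proof.
  intros Hx HC.
  destruct (ex_finite_lim_seq_incr (sum_n x) C) as [l Hl].
  - intros n. rewrite sum_Sn. unfold plus; simpl. specialize (Hx (S n)). lra.
  - intros n. rewrite sum_n_Reals. apply HC.
  - exists l. exact Hl.
Qed.

Lemma ex_series_dom (x y : nat -> R) :
  (forall j, Rabs (x j) <= y j) -> ex_series y -> ex_series x.
Proof. intros H. apply (ex_series_le x y). exact H. Qed.

Lemma Series_le_dom (x y : nat -> R) :
  (forall j, x j <= y j) -> ex_series x -> ex_series y -> Series x <= Series y.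
Proof.
  intros H Hx Hy.
  assert (Hd := is_lim_seq_le (sum_f_R0 x) (sum_f_R0 y) (Series x) (Series y)).
  apply Hd; [| now apply is_series_lim | now apply is_series_lim].
  intros n. apply sum_Rle. intros; apply H.
Qed.

Lemma is_series_finite (x : nat -> R) (n : nat) :
  (forall j, (n < j)%nat -> x j = 0) -> is_series x (sum_f_R0 x n).
Proof.
  intros H. apply filterlim_ext_loc with (fun _ => sum_f_R0 x n).
  - exists n. intros m Hm. induction Hm as [| m Hm IH].
    + symmetry; apply sum_n_Reals.
    + rewrite sum_Sn, <- IH, H by lia. unfold plus; simpl. ring.
  - apply filterlim_const.
Qed.

Lemma ex_series_finite (x : nat -> R) (n : nat) :
  (forall j, (n < j)%nat -> x j = 0) -> ex_series x.
Proof. intros H. exists (sum_f_R0 x n). now apply is_series_finite. Qed.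

Lemma Series_finite (x : nat -> R) (n : nat) :
  (forall j, (n < j)%nat -> x j = 0) -> Series x = sum_f_R0 x n.
Proof. intros H. apply is_series_unique. now apply is_series_finite. Qed.

Definition kron (i j : nat) : R := if Nat.eqb i j then 1 else 0.

Lemma kron_bounds (i j : nat) : 0 <= kron i j <= 1.
Proof. unfold kron. destruct (Nat.eqb i j); lra. Qed.

Definition upto (n : nat) (g : nat -> R) (j : nat) : R := if Nat.leb j n then g j else 0.

Lemma sum_kron (x : nat -> R) (i n : nat) :
  sum_f_R0 (fun j => x j * kron j i) n = if Nat.leb i n then x i else 0.
Proof.
  unfold kron. induction n as [| n IH].
  - simpl. destruct i; simpl; ring.
  - rewrite tech5, IH. destruct (Nat.leb_spec i n), (Nat.leb_spec i (S n)), (Nat.eqb_spec (S n) i);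
    subst; try lia; try ring.
Qed.

Lemma Series_kron (x : nat -> R) (i : nat) :
  ex_series (fun j => x j * kron j i) /\ Series (fun j => x j * kron j i) = x i.
Proof.
  assert (H : forall j, (i < j)%nat -> x j * kron j i = 0).
  { intros j Hj. unfold kron. destruct (Nat.eqb_spec j i); [lia | ring]. }
  split; [now apply ex_series_finite with i |].
  rewrite (Series_finite _ i H), sum_kron, Nat.leb_refl. reflexivity.
Qed.

(** Summation along antidiagonals turns a product of two series into a Cauchy
product, groups collisions by total size as the breakage sums do, and makes the
truncation j + k <= n a partial sum. *)
Definition diag (t : nat -> nat -> R) (m : nat) : R :=
  sum_f_R0 (fun k => t (m - k)%nat k) m.
Definition double_series (t : nat -> nat -> R) : R := Series (diag t).
Definition double_summable (t : nat -> nat -> R) : Prop :=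
  ex_series (diag (fun j k => Rabs (t j k))).

Lemma diag_le (t s : nat -> nat -> R) (m : nat) :
  (forall j k, t j k <= s j k) -> diag t m <= diag s m.
Proof. intros H. apply sum_Rle. intros; apply H. Qed.

Lemma diag_ext (t s : nat -> nat -> R) (m : nat) :
  (forall j k, t j k = s j k) -> diag t m = diag s m.
Proof. intros H. apply sum_eq. intros; apply H. Qed.

Lemma diag_abs (t : nat -> nat -> R) (m : nat) :
  Rabs (diag t m) <= diag (fun j k => Rabs (t j k)) m.
Proof. apply Rsum_abs. Qed.

Lemma diag_plus (t s : nat -> nat -> R) (m : nat) :
  diag (fun j k => t j k + s j k) m = diag t m + diag s m.
Proof. apply (sum_plus (fun k => t (m - k)%nat k) (fun k => s (m - k)%nat k)). Qed.

Lemma diag_scal (c : R) (t : nat -> nat -> R) (m : nat) :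
  diag (fun j k => c * t j k) m = c * diag t m.
Proof.
  unfold diag. rewrite scal_sum. apply sum_eq. intros; ring.
Qed.

Lemma sum_rev (x : nat -> R) (n : nat) :
  sum_f_R0 (fun k => x (n - k)%nat) n = sum_f_R0 x n.
Proof.
  induction n as [| n IH]; [reflexivity |].
  rewrite decomp_sum by lia. simpl Init.Nat.pred. rewrite tech5, <- IH, Rplus_comm.
  f_equal.
Qed.

Lemma diag_swap (t : nat -> nat -> R) (m : nat) :
  diag (fun j k => t k j) m = diag t m.
Proof.
  unfold diag. rewrite <- (sum_rev (fun k => t (m - k)%nat k)). apply sum_eq.
  intros k Hk. f_equal. lia.
Qed.

Lemma double_summable_series (t : nat -> nat -> R) :
  double_summable t -> ex_series (diag t).
Proof. apply ex_series_dom. apply diag_abs. Qed.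

Lemma double_summable_le (t s : nat -> nat -> R) :
  (forall j k, Rabs (t j k) <= s j k) -> double_summable s -> double_summable t.
Proof.
  intros H. apply ex_series_dom. intros m.
  eapply Rle_trans; [apply diag_abs |]. apply diag_le. intros j k.
  rewrite Rabs_Rabsolu. eapply Rle_trans; [apply H | apply Rle_abs].
Qed.

Lemma double_summable_plus (t s : nat -> nat -> R) :
  double_summable t -> double_summable s ->
  double_summable (fun j k => t j k + s j k).
Proof.
  intros Ht Hs.
  apply double_summable_le with (fun j k => Rabs (t j k) + Rabs (s j k)).
  - intros j k. apply Rabs_triang.
  - apply ex_series_ext with (fun m => diag (fun j k => Rabs (t j k)) m
                                       + diag (fun j k => Rabs (s j k)) m).
    + intros m. rewrite <- diag_plus. apply diag_ext. intros j k.
      symmetry; apply Rabs_pos_eq. assert (h1 := Rabs_pos (t j k)).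
      assert (h2 := Rabs_pos (s j k)). lra.
    + now apply (ex_series_plus (V := R_NormedModule)).
Qed.

Lemma double_summable_scal (c : R) (t : nat -> nat -> R) :
  double_summable t -> double_summable (fun j k => c * t j k).
Proof.
  intros Ht. unfold double_summable.
  apply ex_series_ext with (fun m => Rabs c * diag (fun j k => Rabs (t j k)) m).
  - intros m. rewrite <- diag_scal. apply diag_ext. intros j k. symmetry; apply Rabs_mult.
  - now apply (ex_series_scal (V := R_NormedModule)).
Qed.

Lemma double_summable_swap (t : nat -> nat -> R) :
  double_summable t -> double_summable (fun j k => t k j).
Proof.
  apply ex_series_ext. intros m. symmetry. apply (diag_swap (fun j k => Rabs (t j k))).
Qed.

Lemma double_series_swap (t : nat -> nat -> R) :
  double_series (fun j k => t k j) = double_series t.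
Proof. apply Series_ext. apply diag_swap. Qed.

Lemma double_series_ext (t s : nat -> nat -> R) :
  (forall j k, t j k = s j k) -> double_series t = double_series s.
Proof. intros H. apply Series_ext. intros m. now apply diag_ext. Qed.

Lemma double_series_plus (t s : nat -> nat -> R) :
  double_summable t -> double_summable s ->
  double_series (fun j k => t j k + s j k) = double_series t + double_series s.
Proof.
  intros Ht Hs. unfold double_series.
  rewrite <- Series_plus by now apply double_summable_series.
  apply Series_ext. apply diag_plus.
Qed.

Lemma double_series_scal (c : R) (t : nat -> nat -> R) :
  double_series (fun j k => c * t j k) = c * double_series t.
Proof.
  unfold double_series. rewrite <- Series_scal_l. apply Series_ext. apply diag_scal.
Qed.

Lemma double_series_minus (t s : nat -> nat -> R) :
  double_summable t -> double_summable s ->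
  double_series (fun j k => t j k - s j k) = double_series t - double_series s.
Proof.
  intros Ht Hs.
  rewrite (double_series_ext _ (fun j k => t j k + -1 * s j k)) by (intros; ring).
  rewrite double_series_plus, double_series_scal by (try apply double_summable_scal; assumption).
  ring.
Qed.

Lemma double_series_le (t s : nat -> nat -> R) :
  (forall j k, t j k <= s j k) -> double_summable t -> double_summable s ->
  double_series t <= double_series s.
Proof.
  intros H Ht Hs.
  apply Series_le_dom; [| now apply double_summable_series | now apply double_summable_series].
  intros m. now apply diag_le.
Qed.

Lemma double_series_abs_le (t s : nat -> nat -> R) :
  (forall j k, Rabs (t j k) <= s j k) -> double_summable s ->
  Rabs (double_series t) <= double_series s.
Proof.
  intros H Hs. assert (Ht := double_summable_le _ _ H Hs).
  eapply Rle_trans.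
  - apply Series_Rabs. unfold double_summable in Ht.
    apply ex_series_dom with (2 := Ht). intros m.
    rewrite Rabs_Rabsolu. apply diag_abs.
  - apply Series_le_dom.
    + intros m. eapply Rle_trans; [apply diag_abs | apply diag_le; exact H].
    + apply ex_series_dom with (2 := Ht). intros m.
      rewrite Rabs_Rabsolu. apply diag_abs.
    + now apply double_summable_series.
Qed.

Lemma double_series_sum (t : nat -> nat -> nat -> R) (n : nat) :
  (forall i, (i <= n)%nat -> double_summable (t i)) ->
  double_summable (fun j k => sum_f_R0 (fun i => t i j k) n) /\
  double_series (fun j k => sum_f_R0 (fun i => t i j k) n)
  = sum_f_R0 (fun i => double_series (t i)) n.
Proof.
  induction n as [| n IH]; intros H.
  - split; [apply H; lia | reflexivity].
  - destruct IH as [IH1 IH2]; [intros; apply H; lia |].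
    split.
    + apply (double_summable_plus (fun j k => sum_f_R0 (fun i => t i j k) n) (t (S n)));
        [exact IH1 | apply H; lia].
    + rewrite tech5, <- IH2, <- double_series_plus; [reflexivity | exact IH1 | apply H; lia].
Qed.

Lemma double_series_product (x y : nat -> R) :
  (forall j, 0 <= x j) -> (forall k, 0 <= y k) -> ex_series x -> ex_series y ->
  double_summable (fun j k => x j * y k) /\
  double_series (fun j k => x j * y k) = Series x * Series y.
Proof.
  intros Hx Hy Sx Sy.
  assert (H := is_series_mult_pos y x _ _ (Series_correct _ Sy) (Series_correct _ Sx) Hy Hx).
  assert (H' : is_series (diag (fun j k => x j * y k)) (Series x * Series y)).
  { rewrite Rmult_comm. apply is_series_ext with (2 := H).
    intros m. apply sum_eq. intros; ring. }
  split.
  - exists (Series x * Series y). apply is_series_ext with (2 := H').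
    intros m. apply diag_ext. intros j k. symmetry; apply Rabs_pos_eq.
    now apply Rmult_le_pos.
  - now apply is_series_unique.
Qed.

(** Every reaction term below is summable by comparison with such a product,
because the collision rate is bounded by a product of weights. *)
Lemma double_series_dominated (t : nat -> nat -> R) (C : R) (x y : nat -> R) :
  (forall j k, Rabs (t j k) <= C * (x j * y k)) ->
  (forall j, 0 <= x j) -> (forall k, 0 <= y k) -> ex_series x -> ex_series y ->
  double_summable t /\ Rabs (double_series t) <= C * (Series x * Series y).
Proof.
  intros H Hx Hy Sx Sy.
  destruct (double_series_product x y Hx Hy Sx Sy) as [P1 P2].
  assert (HC := double_summable_scal C _ P1).
  split; [now apply double_summable_le with (2 := HC) |].
  rewrite <- P2, <- double_series_scal. now apply double_series_abs_le.
Qed.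

(** * Moments *)

Definition has_moment (g y : nat -> R) : Prop :=
  ex_series (fun j => g j * Rabs (y j)).
Definition moment (g y : nat -> R) : R := Series (fun j => g j * Rabs (y j)).

Definition nonnegative (y : nat -> R) : Prop := forall j, 0 <= y j.

Lemma INR_nonneg : nonnegative INR.
Proof. intros j. apply pos_INR. Qed.

Lemma weighted_nonneg (g y : nat -> R) : nonnegative g -> nonnegative (fun j => g j * Rabs (y j)).
Proof. intros Hg j. apply Rmult_le_pos; [apply Hg | apply Rabs_pos]. Qed.

Lemma moment_nonneg (g y : nat -> R) : nonnegative g -> has_moment g y -> 0 <= moment g y.
Proof.
  intros Hg Hy. apply Series_nonneg; [| exact Hy].
  intros j. apply Rmult_le_pos; [apply Hg | apply Rabs_pos].
Qed.

Lemma moment_le_weight (f g y : nat -> R) :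
  nonnegative f -> (forall j, f j <= g j) -> has_moment g y ->
  has_moment f y /\ moment f y <= moment g y.
Proof.
  intros Hf Hfg Hy. split.
  - apply ex_series_dom with (2 := Hy). intros j.
    rewrite Rabs_mult, Rabs_Rabsolu, (Rabs_pos_eq (f j)) by apply Hf.
    apply Rmult_le_compat_r; [apply Rabs_pos | apply Hfg].
  - apply Series_le; [| exact Hy]. intros j. split.
    + apply Rmult_le_pos; [apply Hf | apply Rabs_pos].
    + apply Rmult_le_compat_r; [apply Rabs_pos | apply Hfg].
Qed.

Lemma moment_triangle (g x y z : nat -> R) :
  nonnegative g -> (forall j, Rabs (x j) <= Rabs (y j) + Rabs (z j)) ->
  has_moment g y -> has_moment g z ->
  has_moment g x /\ moment g x <= moment g y + moment g z.
Proof.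
  intros Hg H Hy Hz.
  assert (Hs := ex_series_plus (V := R_NormedModule) _ _ Hy Hz).
  assert (Hj : forall j, g j * Rabs (x j) <= g j * Rabs (y j) + g j * Rabs (z j)).
  { intros j. rewrite <- Rmult_plus_distr_l. apply Rmult_le_compat_l; auto. }
  assert (Hx : has_moment g x).
  { apply ex_series_dom with (2 := Hs). intros j.
    rewrite Rabs_pos_eq; [apply Hj | apply Rmult_le_pos; [apply Hg | apply Rabs_pos]]. }
  split; [exact Hx |]. unfold moment. rewrite <- Series_plus by assumption.
  now apply Series_le_dom.
Qed.

Lemma moment_minus (g y z : nat -> R) :
  nonnegative g -> has_moment g y -> has_moment g z ->
  has_moment g (fun j => y j - z j) /\
  moment g (fun j => y j - z j) <= moment g y + moment g z.
Proof.
  intros Hg. apply moment_triangle; [exact Hg |]. intros j. apply Rabs_minus_le.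
Qed.

(** Pointwise closeness on finitely many indices together with small tails gives
closeness in the moment; the tails are measured by a weight f that need only
dominate g beyond m. *)
Lemma moment_head_tail (g f x y z : nat -> R) (m : nat) :
  nonnegative g -> nonnegative f ->
  (forall j, (m < j)%nat -> g j <= f j) ->
  (forall j, Rabs (x j) <= Rabs (y j) + Rabs (z j)) ->
  has_moment f y -> has_moment f z ->
  has_moment g x /\
  moment g x <= sum_f_R0 (fun j => g j * Rabs (x j)) m + moment f y + moment f z.
Proof.
  intros Hg Hf Hgf Hx Hy Hz.
  set (head := fun j => if Nat.leb j m then g j * Rabs (x j) else 0).
  assert (Sh : is_series head (sum_f_R0 (fun j => g j * Rabs (x j)) m)).
  { assert (E : sum_f_R0 (fun j => g j * Rabs (x j)) m = sum_f_R0 head m).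
    { apply sum_eq. intros j Hj. unfold head. now rewrite (proj2 (Nat.leb_le j m) Hj). }
    rewrite E. apply is_series_finite. intros j Hj. unfold head.
    now rewrite (proj2 (Nat.leb_gt j m) Hj). }
  assert (Sf := ex_series_plus (V := R_NormedModule) _ _ Hy Hz).
  assert (S := ex_series_plus (V := R_NormedModule) _ _ (ex_intro _ _ Sh) Sf).
  assert (pos : forall j, 0 <= g j * Rabs (x j)).
  { intros j. apply Rmult_le_pos; [apply Hg | apply Rabs_pos]. }
  assert (Hj : forall j, g j * Rabs (x j)
               <= head j + (f j * Rabs (y j) + f j * Rabs (z j))).
  { intros j. rewrite <- Rmult_plus_distr_l.
    assert (h := Rmult_le_compat_l _ _ _ (Hf j) (Hx j)).
    assert (h0 := Rmult_le_pos _ _ (Hf j) (Rabs_pos (x j))).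
    unfold head. destruct (Nat.leb_spec j m) as [Hm | Hm]; [lra |].
    assert (h1 := Rmult_le_compat_r _ _ _ (Rabs_pos (x j)) (Hgf j Hm)). lra. }
  assert (Hgx : has_moment g x).
  { apply ex_series_dom with (2 := S). intros j. rewrite Rabs_pos_eq by apply pos. apply Hj. }
  split; [exact Hgx |].
  eapply Rle_trans; [apply (Series_le_dom _ _ Hj Hgx S) |].
  rewrite Series_plus, Series_plus, (is_series_unique _ _ Sh) by (try assumption; eexists; exact Sh).
  unfold moment. lra.
Qed.

(** * Collision systems and their weak form *)

(** [yield i j k] is the mean number of clusters of size i produced by a collision
of sizes j and k. The rate vanishes when one size is 0, which makes the index 0
inert and lets all sums start there. *)
Record collisions (A alpha : R) : Type := Collisions {
  rate : nat -> nat -> R;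
  yield : nat -> nat -> nat -> R;
  rate_nonneg : forall j k, 0 <= rate j k;
  rate_sym : forall j k, rate j k = rate k j;
  rate_le : forall j k, rate j k <= A * (INR j + INR k);
  rate_0 : forall k, rate 0 k = 0;
  yield_nonneg : forall i j k, 0 <= yield i j k;
  yield_sym : forall i j k, yield i j k = yield i k j;
  yield_le : forall i j k, yield i j k <= alpha;
  yield_large : forall i j k, (j + k < i)%nat -> yield i j k = 0;
  yield_mass : forall j k, (1 <= j)%nat -> (1 <= k)%nat ->
    sum_f_R0 (fun i => INR i * yield i j k) (j + k) = INR j + INR k
}.

Arguments rate {A alpha}.
Arguments yield {A alpha}.

Section System.
Context {A alpha : R} (S : collisions A alpha).

(** The factor 1/2 is there because each unordered pair occurs twice in the
double series; both partners of a collision disappear in it. *)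
Definition net (i j k : nat) : R :=
  / 2 * rate S j k * (yield S i j k - kron i j - kron i k).

Definition production (y : nat -> R) (i : nat) : R :=
  double_series (fun j k => net i j k * (y j * y k)).

Lemma rate_r0 (k : nat) : rate S k 0 = 0.
Proof. rewrite rate_sym. apply rate_0. Qed.

Lemma A_nonneg : 0 <= A.
Proof.
  assert (h := rate_le _ _ S 1 1). assert (h0 := rate_nonneg _ _ S 1 1). simpl in h. lra.
Qed.

Lemma alpha_nonneg : 0 <= alpha.
Proof.
  assert (h := yield_le _ _ S 1 1 1). assert (h0 := yield_nonneg _ _ S 1 1 1). lra.
Qed.

Lemma rate_le_product (j k : nat) : rate S j k <= 2 * A * (INR j * INR k).
Proof.
  assert (hA := A_nonneg).
  destruct (Nat.eq_dec j 0) as [-> | Hj].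
  { rewrite rate_0. simpl. lra. }
  destruct (Nat.eq_dec k 0) as [-> | Hk].
  { rewrite rate_r0. simpl. lra. }
  eapply Rle_trans; [apply rate_le |].
  assert (hj := INR_ge_1 j ltac:(lia)). assert (hk := INR_ge_1 k ltac:(lia)).
  rewrite (Rmult_comm 2 A), Rmult_assoc. apply Rmult_le_compat_l; nra.
Qed.

(** Unbounded as it is, the rate is dominated by the product of the sizes, so the
quadratic terms are controlled by the first moment alone. *)
Lemma net_bound (i j k : nat) :
  Rabs (net i j k) <= A * (alpha + 2) * (INR j * INR k).
Proof.
  unfold net.
  assert (h1 := rate_nonneg _ _ S j k). assert (h2 := rate_le_product j k).
  assert (h3 := yield_nonneg _ _ S i j k). assert (h4 := yield_le _ _ S i j k).
  assert (h5 := kron_bounds i j). assert (h6 := kron_bounds i k).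
  rewrite Rabs_mult, (Rabs_pos_eq (/2 * _)) by lra.
  assert (h7 : Rabs (yield S i j k - kron i j - kron i k) <= alpha + 2) by (apply Rabs_le; lra).
  replace (A * (alpha + 2) * (INR j * INR k))
    with (/2 * (2 * A * (INR j * INR k)) * (alpha + 2)) by field.
  apply Rmult_le_compat; try lra; apply Rabs_pos.
Qed.

Lemma net_sym (i j k : nat) : net i j k = net i k j.
Proof. unfold net. rewrite (rate_sym _ _ S j k), (yield_sym _ _ S i j k). ring. Qed.

Lemma net_summable (i : nat) (x y : nat -> R) :
  has_moment INR x -> has_moment INR y ->
  double_summable (fun j k => net i j k * (x j * y k)) /\
  Rabs (double_series (fun j k => net i j k * (x j * y k)))
  <= A * (alpha + 2) * (moment INR x * moment INR y).
Proof.
  intros Hx Hy.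
  apply double_series_dominated; try (apply weighted_nonneg, INR_nonneg); try assumption.
  intros j k. rewrite !Rabs_mult.
  assert (h := net_bound i j k). assert (h1 := Rabs_pos (x j)). assert (h2 := Rabs_pos (y k)).
  assert (h3 := Rmult_le_pos _ _ h1 h2).
  assert (h4 := Rmult_le_compat_r _ _ _ h3 h). nra.
Qed.

Lemma production_bound (y : nat -> R) (i : nat) :
  has_moment INR y -> Rabs (production y i) <= A * (alpha + 2) * moment INR y ^ 2.
Proof.
  intros Hy. destruct (net_summable i y y Hy Hy) as [_ H].
  simpl. rewrite Rmult_1_r. exact H.
Qed.

(** Polarisation: y_j y_k - z_j z_k = (y_j - z_j) y_k + z_j (y_k - z_k). *)
Lemma production_lipschitz (y z : nat -> R) (i : nat) (M : R) :
  has_moment INR y -> has_moment INR z -> moment INR y <= M -> moment INR z <= M ->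
  Rabs (production y i - production z i)
  <= 2 * A * (alpha + 2) * M * moment INR (fun j => y j - z j).
Proof.
  intros Hy Hz My Mz.
  destruct (moment_minus INR y z INR_nonneg Hy Hz) as [Hd _].
  destruct (net_summable i _ _ Hd Hy) as [S1 B1].
  destruct (net_summable i _ _ Hz Hd) as [S2 B2].
  destruct (net_summable i _ _ Hy Hy) as [Sy _].
  destruct (net_summable i _ _ Hz Hz) as [Sz _].
  unfold production. rewrite <- double_series_minus by assumption.
  rewrite (double_series_ext _ (fun j k => net i j k * ((y j - z j) * y k)
    + net i j k * (z j * (y k - z k)))) by (intros; ring).
  rewrite double_series_plus by assumption.
  eapply Rle_trans; [apply Rabs_triang |].
  eapply Rle_trans; [apply Rplus_le_compat; [exact B1 | exact B2] |].
  assert (hk : 0 <= A * (alpha + 2)).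
  { assert (h := A_nonneg). assert (h' := alpha_nonneg). nra. }
  assert (hd := moment_nonneg _ _ INR_nonneg Hd).
  set (d := moment INR (fun j => y j - z j)) in *.
  set (K := A * (alpha + 2)) in *.
  assert (e1 := Rmult_le_compat_l _ _ _ (Rmult_le_pos _ _ hk hd) My).
  assert (e2 := Rmult_le_compat_l _ _ _ (Rmult_le_pos _ _ hk hd) Mz).
  fold K. replace (2 * A * (alpha + 2) * M * d) with (K * d * M + K * d * M) by (unfold K; ring).
  nra.
Qed.

(** The change of the sum of g i over the sizes i <= n caused by one collision of
j and k. *)
Definition transfer (g : nat -> R) (n j k : nat) : R :=
  / 2 * rate S j k * (sum_f_R0 (fun i => g i * yield S i j k) n - upto n g j - upto n g k).

Lemma transfer_sum (g : nat -> R) (n j k : nat) :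
  transfer g n j k = sum_f_R0 (fun i => g i * net i j k) n.
Proof.
  unfold transfer, upto.
  rewrite <- (sum_kron g j n), <- (sum_kron g k n).
  rewrite <- !minus_sum, <- sum_scal_l.
  apply sum_eq. intros i _. unfold net. ring.
Qed.

Lemma transfer_sym (g : nat -> R) (n j k : nat) : transfer g n j k = transfer g n k j.
Proof. rewrite !transfer_sum. apply sum_eq. intros i _. now rewrite net_sym. Qed.

(** The test weight is cut at n, so only a finite sum is exchanged with the double
series and the growth of g does not matter. *)
Lemma weak_form (g y : nat -> R) (n : nat) :
  has_moment INR y ->
  double_summable (fun j k => transfer g n j k * (y j * y k)) /\
  sum_f_R0 (fun i => g i * production y i) n
  = double_series (fun j k => transfer g n j k * (y j * y k)).
Proof.
  intros Hy.
  destruct (double_series_sum (fun i j k => g i * (net i j k * (y j * y k))) n) as [H1 H2].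
  { intros i _. apply double_summable_scal. now apply net_summable. }
  assert (E : forall j k, sum_f_R0 (fun i => g i * (net i j k * (y j * y k))) n
              = transfer g n j k * (y j * y k)).
  { intros j k. rewrite transfer_sum, (Rmult_comm (sum_f_R0 _ _)), scal_sum.
    apply sum_eq. intros; ring. }
  split.
  -
    apply ex_series_ext with (2 := H1). intros m. apply diag_ext.
    intros j k. now rewrite E.
  - rewrite <- (double_series_ext _ _ E), H2. apply sum_eq.
    intros i _. unfold production. now rewrite <- double_series_scal.
Qed.
End System.

(** * Truncated systems and the explicit Euler scheme *)

Section Truncation.
Context {A alpha : R} (S : collisions A alpha).

(** Discarding whole collisions, and not the large fragments of some, preserves
mass exactly. *)
Definition truncated_rate (n j k : nat) : R := if Nat.leb (j + k) n then rate S j k else 0.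

Lemma truncated_rate_nonneg (n j k : nat) : 0 <= truncated_rate n j k.
Proof. unfold truncated_rate. destruct Nat.leb; [apply rate_nonneg | lra]. Qed.

Lemma truncated_rate_sym (n j k : nat) : truncated_rate n j k = truncated_rate n k j.
Proof.
  unfold truncated_rate. rewrite (Nat.add_comm k j).
  destruct Nat.leb; [apply rate_sym | reflexivity].
Qed.

Lemma truncated_rate_le (n j k : nat) : truncated_rate n j k <= A * (INR j + INR k).
Proof.
  unfold truncated_rate. destruct Nat.leb; [apply rate_le |].
  assert (h := A_nonneg S). assert (h1 := pos_INR j). assert (h2 := pos_INR k). nra.
Qed.

Lemma truncated_rate_0 (n k : nat) : truncated_rate n 0 k = 0.
Proof. unfold truncated_rate. destruct Nat.leb; [apply rate_0 | reflexivity]. Qed.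

Definition truncate (n : nat) : collisions A alpha :=
  Collisions A alpha (truncated_rate n) (yield S)
    (truncated_rate_nonneg n) (truncated_rate_sym n) (truncated_rate_le n)
    (truncated_rate_0 n) (yield_nonneg _ _ S) (yield_sym _ _ S) (yield_le _ _ S)
    (yield_large _ _ S) (yield_mass _ _ S).

Lemma production_truncate_large (n i : nat) (y : nat -> R) :
  (n < i)%nat -> production (truncate n) y i = 0.
Proof.
  intros Hi. unfold production.
  rewrite (double_series_ext _ (fun j k => 0 * (y j * y k))).
  - rewrite double_series_scal. ring.
  - intros j k. f_equal. unfold net. simpl. unfold truncated_rate.
    destruct (Nat.leb_spec (j + k) n); [| ring].
    rewrite (yield_large _ _ S) by lia. unfold kron.
    destruct (Nat.eqb_spec i j), (Nat.eqb_spec i k); try lia. ring.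
Qed.

Definition euler_step (n : nat) (h : R) (y : nat -> R) (i : nat) : R :=
  y i + h * production (truncate n) y i.

Lemma euler_step_moment (g y : nat -> R) (n : nat) (h : R) :
  nonnegative y -> nonnegative (euler_step n h y) -> has_moment g y ->
  has_moment g (euler_step n h y) /\
  moment g (euler_step n h y)
  = moment g y + h * sum_f_R0 (fun i => g i * production (truncate n) y i) n.
Proof.
  intros Hy Hy' Hg.
  set (F := fun i => g i * production (truncate n) y i).
  assert (HF : forall i, (n < i)%nat -> F i = 0).
  { intros i Hi. unfold F. rewrite production_truncate_large by exact Hi. ring. }
  assert (E : forall j, g j * Rabs (y j) + h * F j = g j * Rabs (euler_step n h y j)).
  { intros j. rewrite !Rabs_pos_eq by (apply Hy || apply Hy'). unfold euler_step, F. ring. }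
  assert (SF : ex_series (fun j => h * F j)).
  { apply ex_series_finite with n. intros j Hj. rewrite HF by exact Hj. ring. }
  split.
  - apply ex_series_ext with (1 := E).
    now apply (ex_series_plus (V := R_NormedModule)).
  - unfold moment. rewrite <- (Series_ext _ _ E), Series_plus by assumption.
    now rewrite Series_scal_l, (Series_finite F n HF).
Qed.

(** In the truncated system a cluster of size i disappears at a rate at most
A n M, with M the first moment, so under this step condition one Euler step
removes at most the whole of y i. *)
Lemma euler_step_nonneg (n : nat) (h : R) (y : nat -> R) :
  nonnegative y -> has_moment INR y -> 0 <= h -> h * (A * INR n * moment INR y) <= 1 ->
  nonnegative (euler_step n h y).
Proof.
  intros Hy Hm Hh Hstep i. unfold euler_step.
  set (K := A * INR n) in *.
  assert (hA := A_nonneg S). assert (hn := pos_INR n).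
  assert (hK : 0 <= K) by (unfold K; nra).
  destruct (Series_kron y i) as [Sy Ey].
  assert (Hky : forall j, 0 <= y j * kron j i).
  { intros j. apply Rmult_le_pos; [apply Hy | apply kron_bounds]. }
  destruct (double_series_product (fun j => y j * kron j i) (fun k => INR k * Rabs (y k)))
    as [P1 P2]; [exact Hky | apply weighted_nonneg, INR_nonneg | exact Sy | exact Hm |].
  rewrite Ey in P2. fold (moment INR y) in P2.
  set (p := fun j k => y j * kron j i * (INR k * Rabs (y k))) in *.
  set (loss := fun j k => - (K * / 2) * p j k + - (K * / 2) * p k j).
  assert (Hl : double_summable loss).
  { apply double_summable_plus; apply double_summable_scal; [exact P1 |].
    now apply double_summable_swap. }
  assert (EL : double_series loss = - K * (y i * moment INR y)).
  { unfold loss. rewrite double_series_plus;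
      try (apply double_summable_scal; (exact P1 || now apply double_summable_swap)).
    rewrite (double_series_scal _ (fun j k => p k j)), (double_series_scal _ p), (double_series_swap p), P2.
    field. }
  assert (Hp : - K * (y i * moment INR y) <= production (truncate n) y i).
  { rewrite <- EL. apply double_series_le; [| exact Hl |].
    2:{ now apply net_summable. }
    intros j k. unfold loss, net, p. simpl.
    assert (hr0 := rate_nonneg _ _ (truncate n) j k). simpl in hr0.
    assert (hr : forall j k, truncated_rate n j k <= K * INR k).
    { clear j k hr0. intros j k. unfold truncated_rate.
      destruct (Nat.eq_dec k 0) as [-> | Hk].
      - rewrite (rate_r0 S). simpl. destruct Nat.leb; lra.
      - assert (hk := INR_ge_1 k ltac:(lia)). destruct (Nat.leb_spec (j + k) n) as [Hjk | Hjk]; [| nra].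
        apply le_INR in Hjk. rewrite plus_INR in Hjk.
        eapply Rle_trans; [apply rate_le |]. unfold K.
        apply Rle_trans with (A * INR n); [apply Rmult_le_compat_l; lra |].
        rewrite <- (Rmult_1_r (A * INR n)) at 1. apply Rmult_le_compat_l; [exact hK | exact hk]. }
    assert (hr1 := hr j k). assert (hr2 := hr k j).
    assert (hs : truncated_rate n k j = truncated_rate n j k).
    { apply (rate_sym _ _ (truncate n)). }
    rewrite hs in hr2.
    rewrite !Rabs_pos_eq by apply Hy.
    unfold kron. rewrite (Nat.eqb_sym j i), (Nat.eqb_sym k i).
    assert (hy := yield_nonneg _ _ S i j k).
    assert (hyy := Rmult_le_pos _ _ (Hy j) (Hy k)).
    assert (h1 : 0 <= truncated_rate n j k * yield S i j k * (y j * y k)).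
    { apply Rmult_le_pos; [| exact hyy]. now apply Rmult_le_pos. }
    assert (h2 := Rmult_le_compat_r _ _ _ hyy hr1).
    assert (h3 := Rmult_le_compat_r _ _ _ hyy hr2).
    destruct (Nat.eqb i j), (Nat.eqb i k); nra. }
  assert (h1 := Rmult_le_compat_l h _ _ Hh Hp).
  assert (h2 := Rmult_le_compat_l (y i) _ _ (Hy i) Hstep).
  nra.
Qed.

Definition euler (n : nat) (h : R) (y : nat -> R) (r : nat) : nat -> R :=
  Nat.iter r (euler_step n h) y.

Lemma transfer_mass (n j k : nat) : transfer (truncate n) INR n j k = 0.
Proof.
  unfold transfer. simpl. unfold truncated_rate.
  destruct (Nat.leb_spec (j + k) n) as [Hjk | Hjk]; [| ring].
  destruct (Nat.eq_dec j 0) as [-> | Hj]; [rewrite rate_0; ring |].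
  destruct (Nat.eq_dec k 0) as [-> | Hk]; [rewrite (rate_r0 S); ring |].
  rewrite (sum_extend _ (j + k) n Hjk).
  2:{ intros i Hi. rewrite (yield_large _ _ S i j k Hi). ring. }
  rewrite (yield_mass _ _ S) by lia. unfold upto.
  rewrite !(proj2 (Nat.leb_le _ n)) by lia. ring.
Qed.

Lemma euler_invariants (n : nat) (h : R) (y : nat -> R) (r : nat) :
  nonnegative y -> has_moment INR y -> 0 <= h -> h * (A * INR n * moment INR y) <= 1 ->
  nonnegative (euler n h y r) /\ has_moment INR (euler n h y r) /\
  moment INR (euler n h y r) = moment INR y.
Proof.
  intros Hy Hm Hh Hs. induction r as [| r [IH1 [IH2 IH3]]]; [now repeat split |].
  change (euler n h y (Datatypes.S r)) with (euler_step n h (euler n h y r)).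
  assert (Hn : nonnegative (euler_step n h (euler n h y r))).
  { apply euler_step_nonneg; try assumption. now rewrite IH3. }
  destruct (euler_step_moment INR _ n h IH1 Hn IH2) as [H1 H2].
  split; [exact Hn |]. split; [exact H1 |].
  rewrite H2, IH3. destruct (weak_form (truncate n) INR _ n IH2) as [_ E].
  rewrite E, (double_series_ext _ (fun j k => 0 * (euler n h y r j * euler n h y r k))).
  - rewrite double_series_scal. ring.
  - intros j k. now rewrite transfer_mass.
Qed.

(** The weights whose moments are propagated: the monotonicity of g(i)/i makes
breakage harmless, that of g(i)/i^3 limits the effect of merging. *)
Definition moderate (g : nat -> R) : Prop :=
  nonnegative g /\ g 0%nat = 0 /\
  (forall i j, (1 <= i <= j)%nat -> g i * INR j <= g j * INR i) /\
  (forall i j, (1 <= i <= j)%nat -> g j * INR i ^ 3 <= g i * INR j ^ 3).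

(** For j <= k one has g(j+k) <= (1 + j/k)^3 g(k) <= (1 + 7 j/k) g(k), and
j + k <= 2 k. *)
Lemma moderate_increment (g : nat -> R) (j k : nat) :
  moderate g -> (1 <= j)%nat -> (1 <= k)%nat ->
  (INR j + INR k) * (g (j + k)%nat - g j - g k) <= 14 * (g j * INR k + INR j * g k).
Proof.
  intros [Hg [_ [_ H3]]].
  assert (W : forall j k, (1 <= j <= k)%nat ->
    (INR j + INR k) * (g (j + k)%nat - g j - g k) <= 14 * (g j * INR k + INR j * g k)).
  { clear j k. intros j k Hjk.
    assert (h := H3 k (j + k)%nat ltac:(lia)). rewrite plus_INR in h.
    assert (hj := INR_ge_1 j ltac:(lia)). assert (hk : INR j <= INR k) by (apply le_INR; lia).
    assert (gj := Hg j). assert (gk := Hg k).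
    set (G := g (j + k)%nat) in *. set (x := INR j) in *. set (z := INR k) in *.
    assert (e : (x + z) ^ 3 <= z ^ 2 * (z + 7 * x)).
    { assert (x * x <= x * z) by nra. assert (x * x * x <= x * z * z) by nra. nra. }
    assert (e1 : G * z ^ 3 <= g k * (z ^ 2 * (z + 7 * x))).
    { apply Rle_trans with (1 := h). now apply Rmult_le_compat_l. }
    assert (e2 : G * z <= g k * (z + 7 * x)).
    { apply Rmult_le_reg_r with (z ^ 2); [nra |]. nra. }
    assert (0 <= g j * z) by nra. assert (0 <= x * g k) by nra.
    destruct (Rle_dec (G - g k) 0) as [Hn | Hp].
    - assert (G - g j - g k <= 0) by lra. nra.
    - assert ((x + z) * (G - g k) <= 2 * z * (G - g k)) by (apply Rmult_le_compat_r; lra).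
      assert (0 <= (x + z) * g j) by nra. nra. }
  intros Hj Hk. destruct (Nat.le_ge_cases j k) as [H | H].
  - apply W; lia.
  - assert (w := W k j ltac:(lia)). rewrite (Nat.add_comm k j) in w. lra.
Qed.

(** Since g(i)/i is nondecreasing, fragments of total size j + k have a g-moment of
at most g(j+k): the outcome of a collision is never worse than merging. *)
Lemma transfer_moderate (g : nat -> R) (n j k : nat) :
  moderate g ->
  transfer (truncate n) g n j k <= 7 * A * (g j * INR k + INR j * g k).
Proof.
  intros Hm. assert (hA := A_nonneg S). assert (Hg := proj1 Hm).
  assert (gj := Hg j). assert (gk := Hg k). assert (pj := pos_INR j). assert (pk := pos_INR k).
  assert (rhs : 0 <= g j * INR k + INR j * g k) by nra.
  assert (rhs' : 0 <= 7 * A * (g j * INR k + INR j * g k)) by (apply Rmult_le_pos; lra).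
  unfold transfer. simpl. unfold truncated_rate.
  destruct (Nat.leb_spec (j + k) n) as [Hjk | Hjk]; [| lra].
  destruct (Nat.eq_dec j 0) as [-> | Hj]; [rewrite rate_0; lra |].
  destruct (Nat.eq_dec k 0) as [-> | Hk]; [rewrite (rate_r0 S); lra |].
  rewrite (sum_extend _ (j + k) n Hjk).
  2:{ intros i Hi. rewrite (yield_large _ _ S i j k Hi). ring. }
  unfold upto. rewrite !(proj2 (Nat.leb_le _ n)) by lia.
  assert (hj := INR_ge_1 j ltac:(lia)). assert (hk := INR_ge_1 k ltac:(lia)).
  assert (Hy : sum_f_R0 (fun i => g i * yield S i j k) (j + k) <= g (j + k)%nat).
  { apply Rmult_le_reg_r with (INR j + INR k); [lra |].
    rewrite <- (yield_mass _ _ S j k) at 2 by lia.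
    rewrite Rmult_comm, <- !sum_scal_l. apply sum_Rle. intros i Hi.
    destruct Hm as [_ [g0 [H2 _]]].
    destruct (Nat.eq_dec i 0) as [-> | Hi0]; [rewrite g0; simpl; lra |].
    assert (h := H2 i (j + k)%nat ltac:(lia)). rewrite plus_INR in h.
    assert (hy := Rmult_le_compat_r _ _ _ (yield_nonneg _ _ S i j k) h). lra. }
  assert (hinc := moderate_increment g j k Hm ltac:(lia) ltac:(lia)).
  assert (hr0 := rate_nonneg _ _ S j k). assert (hr := rate_le _ _ S j k).
  set (D := g (j + k)%nat - g j - g k) in *.
  apply Rle_trans with (/ 2 * rate S j k * D); [apply Rmult_le_compat_l; unfold D; lra |].
  destruct (Rle_dec D 0) as [Hn | Hp].
  - apply Rle_trans with (2 := rhs'). nra.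
  - apply Rle_trans with (/ 2 * (A * (INR j + INR k)) * D); [apply Rmult_le_compat_r; lra |].
    assert (h := Rmult_le_compat_l _ _ _ hA hinc). lra.
Qed.

Lemma euler_moderate_step (g y : nat -> R) (n : nat) (h : R) :
  moderate g -> nonnegative y -> nonnegative (euler_step n h y) -> 0 <= h ->
  has_moment INR y -> has_moment g y ->
  has_moment g (euler_step n h y) /\
  moment g (euler_step n h y) <= (1 + 14 * A * moment INR y * h) * moment g y.
Proof.
  intros Hmod Hy Hy' Hh Hm Hg.
  destruct (euler_step_moment g y n h Hy Hy' Hg) as [H1 H2].
  split; [exact H1 |]. rewrite H2.
  destruct (weak_form (truncate n) g y n Hm) as [W1 W2]. rewrite W2.
  destruct (double_series_product (fun j => g j * Rabs (y j)) (fun k => INR k * Rabs (y k)))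
    as [P1 P2]; try apply weighted_nonneg; try assumption;
    [apply Hmod | apply INR_nonneg |].
  fold (moment g y) in P2. fold (moment INR y) in P2.
  set (p := fun j k => g j * Rabs (y j) * (INR k * Rabs (y k))) in *.
  assert (Hle : double_series (fun j k => transfer (truncate n) g n j k * (y j * y k))
     <= 14 * A * (moment g y * moment INR y)).
  { replace (14 * A * (moment g y * moment INR y))
      with (double_series (fun j k => 7 * A * p j k + 7 * A * p k j)).
    - apply double_series_le; [| exact W1 |].
      + intros j k. unfold p. rewrite !Rabs_pos_eq by apply Hy.
        assert (hyy := Rmult_le_pos _ _ (Hy j) (Hy k)).
        assert (ht := Rmult_le_compat_r _ _ _ hyy (transfer_moderate g n j k Hmod)).
        lra.
      + apply double_summable_plus; apply double_summable_scal; [exact P1 |].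
        now apply double_summable_swap.
    - rewrite double_series_plus;
        try (apply double_summable_scal; (exact P1 || now apply double_summable_swap)).
      rewrite (double_series_scal _ (fun j k => p k j)), (double_series_scal _ p), (double_series_swap p), P2.
      ring. }
  assert (hh := Rmult_le_compat_l _ _ _ Hh Hle). lra.
Qed.

(** Discrete Gronwall inequality. The growth rate involves the conserved first
moment only, so the bound is linear in the g-moment and its constant is the
same for all moderate weights; this is what propagates smallness of tails. *)
Lemma euler_moderate (g y : nat -> R) (n : nat) (h : R) (r : nat) :
  moderate g -> nonnegative y -> 0 <= h -> h * (A * INR n * moment INR y) <= 1 ->
  has_moment INR y -> has_moment g y ->
  has_moment g (euler n h y r) /\
  moment g (euler n h y r) <= exp (14 * A * moment INR y * (INR r * h)) * moment g y.
Proof.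
  intros Hmod Hy Hh Hs Hm Hg. induction r as [| r [IH1 IH2]].
  - split; [exact Hg |]. simpl. rewrite Rmult_0_l, Rmult_0_r, exp_0. lra.
  - destruct (euler_invariants n h y r Hy Hm Hh Hs) as [I1 [I2 I3]].
    destruct (euler_invariants n h y (Datatypes.S r) Hy Hm Hh Hs) as [J1 _].
    change (euler n h y (Datatypes.S r)) with (euler_step n h (euler n h y r)) in *.
    destruct (euler_moderate_step g _ n h Hmod I1 J1 Hh I2 IH1) as [K1 K2].
    split; [exact K1 |]. rewrite I3 in K2.
    set (c := 14 * A * moment INR y) in *.
    assert (hc : 0 <= c).
    { assert (hA := A_nonneg S). assert (hM := moment_nonneg _ _ INR_nonneg Hm). unfold c. nra. }
    replace (c * (INR (Datatypes.S r) * h)) with (c * h + c * (INR r * h)) by (rewrite S_INR; ring).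
    rewrite exp_plus, Rmult_assoc. apply Rle_trans with (1 := K2).
    assert (hm := moment_nonneg _ _ (proj1 Hmod) IH1).
    assert (hch : 0 <= c * h) by now apply Rmult_le_pos.
    apply Rmult_le_compat; [lra | exact hm | | exact IH2].
    destruct (Req_dec (c * h) 0) as [E | E]; [rewrite E, exp_0; lra |].
    left. apply exp_ineq1. lra.
Qed.

(** The discrete form of a first-order expansion: if the slopes met on the way stay
within B of F, so does the average slope. *)
Lemma euler_increment (n : nat) (h : R) (y : nat -> R) (i k d : nat) (F B : R) :
  0 <= h ->
  (forall r, (k <= r < k + d)%nat ->
     Rabs (production (truncate n) (euler n h y r) i - F) <= B) ->
  Rabs (euler n h y (k + d) i - euler n h y k i - INR d * h * F) <= INR d * h * B.
Proof.
  intros Hh. induction d as [| d IH]; intros H.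
  - rewrite Nat.add_0_r. simpl INR. rewrite !Rmult_0_l, !Rminus_diag, Rabs_R0. lra.
  - rewrite Nat.add_succ_r.
    change (euler n h y (Datatypes.S (k + d))) with (euler_step n h (euler n h y (k + d))).
    unfold euler_step. rewrite S_INR.
    set (P := production (truncate n) (euler n h y (k + d)) i).
    assert (h1 : Rabs (P - F) <= B) by (apply H; lia).
    assert (h2 := IH ltac:(intros; apply H; lia)).
    replace (_ + h * P - _ - _) with
      ((euler n h y (k + d) i - euler n h y k i - INR d * h * F) + h * (P - F)) by ring.
    apply Rle_trans with (1 := Rabs_triang _ _). rewrite Rabs_mult, (Rabs_pos_eq h Hh).
    assert (h3 := Rmult_le_compat_l _ _ _ Hh h1). lra.
Qed.
End Truncation.

(** * Tails of moments and the weights that control them *)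

Definition beyond (n : nat) (g : nat -> R) (j : nat) : R := if Nat.leb j n then 0 else g j.

Lemma beyond_nonneg (n : nat) (g : nat -> R) : nonnegative g -> nonnegative (beyond n g).
Proof. intros Hg j. unfold beyond. destruct Nat.leb; [lra | apply Hg]. Qed.

Lemma beyond_le (n : nat) (g : nat -> R) : nonnegative g -> forall j, beyond n g j <= g j.
Proof. intros Hg j. unfold beyond. destruct Nat.leb; [apply Hg | lra]. Qed.

Lemma moment_beyond (n : nat) (g y : nat -> R) :
  nonnegative g -> has_moment g y ->
  has_moment (beyond n g) y /\
  moment g y = sum_f_R0 (fun j => g j * Rabs (y j)) n + moment (beyond n g) y.
Proof.
  intros Hg Hy.
  destruct (moment_le_weight _ g y (beyond_nonneg n g Hg) (beyond_le n g Hg) Hy) as [Hb _].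
  split; [exact Hb |].
  set (head := upto n (fun j => g j * Rabs (y j))).
  assert (Sh : is_series head (sum_f_R0 (fun j => g j * Rabs (y j)) n)).
  { replace (sum_f_R0 _ n) with (sum_f_R0 head n).
    - apply is_series_finite. intros j Hj. unfold head, upto.
      now rewrite (proj2 (Nat.leb_gt j n) Hj).
    - apply sum_eq. intros j Hj. unfold head, upto. now rewrite (proj2 (Nat.leb_le j n) Hj). }
  rewrite <- (is_series_unique _ _ Sh). unfold moment.
  rewrite <- Series_plus; [| eexists; exact Sh | exact Hb].
  apply Series_ext. intros j. unfold head, upto, beyond. destruct Nat.leb; ring.
Qed.

Lemma beyond_vanishes (g y : nat -> R) (eps : R) :
  nonnegative g -> has_moment g y -> 0 < eps ->
  exists n, forall m, (n <= m)%nat -> moment (beyond m g) y < eps.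
Proof.
  intros Hg Hy He.
  assert (H := is_series_lim _ Hy). apply is_lim_seq_spec in H.
  destruct (H (mkposreal eps He)) as [n Hn]. exists n. intros m Hm.
  destruct (moment_beyond m g y Hg Hy) as [_ E].
  specialize (Hn m Hm). simpl in Hn. fold (moment g y) in Hn. rewrite E in Hn.
  apply Rabs_def2 in Hn. lra.
Qed.

(** The exponent 2 leaves room for one more factor min(1, i/m), whose quotient by i
is nonincreasing, within the exponent 3 of [moderate]. *)
Definition growth_weight (g : nat -> R) : Prop :=
  nonnegative g /\ g 0%nat = 0 /\ (forall j, INR j <= g j) /\
  (forall i j, (1 <= i <= j)%nat -> g i * INR j <= g j * INR i) /\
  (forall i j, (1 <= i <= j)%nat -> g j * INR i ^ 2 <= g i * INR j ^ 2).

(** Equal to g beyond m and damped below, but without the jump of a cut-off, which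
would not be [moderate]. *)
Definition tail_weight (g : nat -> R) (m j : nat) : R :=
  g j * Rmin 1 (INR j / INR (S m)).

Lemma tail_weight_eq (g : nat -> R) (m j : nat) : (m < j)%nat -> tail_weight g m j = g j.
Proof.
  intros H. unfold tail_weight. rewrite Rmin_left; [ring |].
  assert (h : 0 < INR (S m)) by (apply lt_0_INR; lia).
  apply Rmult_le_reg_r with (1 := h). unfold Rdiv. rewrite Rmult_assoc, Rinv_l by lra.
  rewrite Rmult_1_l, Rmult_1_r. apply le_INR. lia.
Qed.

Lemma tail_weight_moderate (g : nat -> R) (m : nat) :
  growth_weight g -> moderate (tail_weight g m).
Proof.
  intros [Hg [g0 [_ [H1 H2]]]].
  assert (hm : 0 < INR (S m)) by (apply lt_0_INR; lia).
  assert (hinv := Rinv_0_lt_compat _ hm).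
  unfold tail_weight, Rdiv. set (c := / INR (S m)) in *.
  split; [| split; [| split]].
  - intros j. apply Rmult_le_pos; [apply Hg |]. apply Rmin_glb; [lra |].
    apply Rmult_le_pos; [apply pos_INR | lra].
  - rewrite g0. ring.
  - intros i j Hij. specialize (H1 i j Hij).
    assert (hij : INR i <= INR j) by (apply le_INR; lia).
    assert (hi := INR_ge_1 i ltac:(lia)).
    assert (gi := Hg i). assert (gj := Hg j).
    assert (Rmin 1 (INR i * c) <= Rmin 1 (INR j * c)).
    { apply Rle_min_compat_l. nra. }
    assert (0 <= Rmin 1 (INR i * c)) by (apply Rmin_glb; nra).
    assert (0 <= g i * INR j) by nra.
    replace (_ * _ * INR j) with (g i * INR j * Rmin 1 (INR i * c)) by ring.
    replace (_ * _ * INR i) with (g j * INR i * Rmin 1 (INR j * c)) by ring.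
    now apply Rmult_le_compat.
  - intros i j Hij. specialize (H2 i j Hij).
    assert (hij : INR i <= INR j) by (apply le_INR; lia).
    assert (hi := INR_ge_1 i ltac:(lia)).
    assert (gi := Hg i). assert (gj := Hg j).
    assert (Rmin 1 (INR j * c) * INR i <= Rmin 1 (INR i * c) * INR j).
    { unfold Rmin. destruct (Rle_dec 1 (INR j * c)), (Rle_dec 1 (INR i * c)); nra. }
    assert (0 <= Rmin 1 (INR j * c)) by (apply Rmin_glb; nra).
    replace (_ * _ * INR i ^ 3) with (g j * INR i ^ 2 * (Rmin 1 (INR j * c) * INR i)) by ring.
    replace (_ * _ * INR j ^ 3) with (g i * INR j ^ 2 * (Rmin 1 (INR i * c) * INR j)) by ring.
    apply Rmult_le_compat; try assumption; [nra |]. apply Rmult_le_pos; lra.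
Qed.

Lemma tail_weight_le (g : nat -> R) (m j : nat) : nonnegative g -> tail_weight g m j <= g j.
Proof.
  intros Hg. unfold tail_weight. rewrite <- (Rmult_1_r (g j)) at 2.
  apply Rmult_le_compat_l; [apply Hg | apply Rmin_l].
Qed.

(** Below an index k the damping is at most k/(m+1), and beyond k the moment of g is
already small. *)
Lemma tail_weight_vanishes (g y : nat -> R) (eps : R) :
  growth_weight g -> has_moment g y -> 0 < eps ->
  exists m, moment (tail_weight g m) y < eps.
Proof.
  intros Hw Hy He. assert (Hg := proj1 Hw).
  destruct (beyond_vanishes g y (eps / 2) Hg Hy ltac:(lra)) as [k Hk].
  specialize (Hk k (Nat.le_refl k)).
  assert (hM := moment_nonneg _ _ Hg Hy). set (M := moment g y) in *.
  assert (hX : 0 <= INR k * M) by (apply Rmult_le_pos; [apply pos_INR | exact hM]).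
  destruct (nfloor_ex (2 * (INR k * M) / eps)) as [m [_ Hm]].
  { apply Rmult_le_pos; [lra |]. left. now apply Rinv_0_lt_compat. }
  exists m. rewrite <- S_INR in Hm.
  assert (hm : 0 < INR (S m)) by (apply lt_0_INR; lia).
  assert (hinv := Rinv_0_lt_compat _ hm).
  destruct (moment_beyond k g y Hg Hy) as [Hb _].
  assert (Hsum := ex_series_plus (V := R_NormedModule) _ _
     (ex_series_scal (V := R_NormedModule) (INR k / INR (S m)) _ Hy) Hb).
  assert (Hmod := proj1 (tail_weight_moderate g m Hw)).
  assert (Ht : has_moment (tail_weight g m) y).
  { eapply moment_le_weight; [exact Hmod | | exact Hy]. intros j. now apply tail_weight_le. }
  apply Rle_lt_trans with (INR k / INR (S m) * M + moment (beyond k g) y).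
  - unfold M, moment. rewrite <- Series_scal_l, <- Series_plus;
      [| apply (ex_series_scal (V := R_NormedModule)); exact Hy | exact Hb].
    apply Series_le_dom; [| exact Ht | exact Hsum].
    intros j. assert (hy := Rabs_pos (y j)). assert (hg := Hg j).
    assert (hgy := Rmult_le_pos _ _ hg hy).
    assert (hk := pos_INR k).
    unfold beyond. destruct (Nat.leb_spec j k) as [Hj | Hj].
    + apply le_INR in Hj. unfold tail_weight.
      assert (Rmin 1 (INR j / INR (S m)) <= INR k / INR (S m)).
      { apply Rle_trans with (1 := Rmin_r _ _). apply Rmult_le_compat_r; lra. }
      apply Rle_trans with (g j * Rabs (y j) * (INR k / INR (S m))); [| lra].
      rewrite (Rmult_comm (g j)), Rmult_assoc, Rmult_comm. now apply Rmult_le_compat_l.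
    + assert (h := tail_weight_le g m j Hg).
      assert (0 <= INR k / INR (S m)) by (apply Rmult_le_pos; lra).
      assert (tail_weight g m j * Rabs (y j) <= g j * Rabs (y j)) by now apply Rmult_le_compat_r.
      assert (0 <= INR k / INR (S m) * (g j * Rabs (y j))) by now apply Rmult_le_pos.
      lra.
  - assert (INR k / INR (S m) * M < eps / 2); [| lra].
    apply Rmult_lt_reg_r with (INR (S m)); [exact hm |].
    replace (INR k / INR (S m) * M * INR (S m)) with (INR k * M) by (field; lra).
    apply Rmult_lt_reg_r with (2 * / eps); [apply Rmult_lt_0_compat; [lra | now apply Rinv_0_lt_compat] |].
    replace (eps / 2 * INR (S m) * (2 * / eps)) with (INR (S m)) by (field; lra).
    replace (INR k * M * (2 * / eps)) with (2 * (INR k * M) / eps) by (field; lra).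
    exact Hm.
Qed.

Lemma growth_weight_moderate (g : nat -> R) : growth_weight g -> moderate g.
Proof.
  intros [Hg [g0 [_ [H1 H2]]]]. split; [exact Hg |]. split; [exact g0 |]. split; [exact H1 |].
  intros i j Hij. specialize (H2 i j Hij).
  assert (hij : INR i <= INR j) by (apply le_INR; lia). assert (hi := INR_ge_1 i ltac:(lia)).
  assert (gi := Hg i). assert (gj := Hg j).
  replace (g j * INR i ^ 3) with (g j * INR i ^ 2 * INR i) by ring.
  replace (g i * INR j ^ 3) with (g i * INR j ^ 2 * INR j) by ring.
  apply Rmult_le_compat; try lra. nra.
Qed.

(** * Limits along a filter *)

Section Limits.
Context {U : (nat -> Prop) -> Prop} {HU : ProperFilter U}.

Definition tends (u : nat -> R) (l : R) : Prop := filterlim u U (locally l).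

Lemma tends_spec (u : nat -> R) (l : R) :
  tends u l <-> forall eps, 0 < eps -> U (fun n => Rabs (u n - l) < eps).
Proof.
  unfold tends. rewrite filterlim_locally. split.
  - intros H eps He. exact (H (mkposreal eps He)).
  - intros H eps. exact (H eps (cond_pos eps)).
Qed.

Lemma tends_const (c : R) : tends (fun _ => c) c.
Proof. apply filterlim_const. Qed.

Lemma tends_plus (u v : nat -> R) (l m : R) :
  tends u l -> tends v m -> tends (fun n => u n + v n) (l + m).
Proof. intros Hu Hv. exact (@filterlim_comp_2 nat R R R U (locally l) (locally m) (locally (l + m)) _ u v Rplus Hu Hv (filterlim_plus (V := R_NormedModule) l m)). Qed.

Lemma tends_mult (u v : nat -> R) (l m : R) :
  tends u l -> tends v m -> tends (fun n => u n * v n) (l * m).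
Proof. intros Hu Hv. exact (@filterlim_comp_2 nat R R R U (locally l) (locally m) (locally (l * m)) _ u v Rmult Hu Hv (filterlim_mult (K := R_AbsRing) l m)). Qed.

Lemma tends_opp (u : nat -> R) (l : R) : tends u l -> tends (fun n => - u n) (- l).
Proof. intros Hu. exact (filterlim_comp _ _ _ _ _ _ _ _ Hu (filterlim_opp (V := R_NormedModule) l)). Qed.

Lemma tends_minus (u v : nat -> R) (l m : R) :
  tends u l -> tends v m -> tends (fun n => u n - v n) (l - m).
Proof. intros Hu Hv. apply tends_plus; [exact Hu | now apply tends_opp]. Qed.

Lemma tends_abs (u : nat -> R) (l : R) : tends u l -> tends (fun n => Rabs (u n)) (Rabs l).
Proof. intros Hu. exact (filterlim_comp _ _ _ _ _ _ _ _ Hu (filterlim_norm (V := R_NormedModule) l)). Qed.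

Lemma tends_le (u v : nat -> R) (l m : R) :
  tends u l -> tends v m -> (forall n, u n <= v n) -> l <= m.
Proof.
  intros Hu Hv H.
  apply (filterlim_le (F := U) u v l m); [| exact Hu | exact Hv].
  apply filter_imp with (2 := filter_true). intros n _. apply H.
Qed.

Lemma tends_unique (u : nat -> R) (l m : R) : tends u l -> tends u m -> l = m.
Proof.
  intros Hl Hm. apply Rle_antisym; eapply tends_le; try eassumption; intros; lra.
Qed.

Lemma tends_sum (u : nat -> nat -> R) (l : nat -> R) (m : nat) :
  (forall j, tends (fun n => u n j) (l j)) ->
  tends (fun n => sum_f_R0 (u n) m) (sum_f_R0 l m).
Proof.
  intros H. induction m as [| m IH]; [apply H |].
  apply (tends_plus _ _ _ _ IH (H (S m))).
Qed.

(** Fatou's lemma, through the partial sums. *)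
Lemma moment_of_limit (g : nat -> R) (x : nat -> nat -> R) (y : nat -> R) (C : R) :
  nonnegative g -> (forall j, tends (fun n => x n j) (y j)) ->
  (forall n, has_moment g (x n) /\ moment g (x n) <= C) ->
  has_moment g y /\ moment g y <= C.
Proof.
  intros Hg Hlim Hx.
  assert (Hp : forall m, sum_f_R0 (fun j => g j * Rabs (y j)) m <= C).
  { intros m. eapply tends_le; [| apply (tends_const C) |].
    - apply (tends_sum (fun n j => g j * Rabs (x n j))). intros j.
      apply tends_mult; [apply tends_const | now apply tends_abs].
    - intros n. destruct (Hx n) as [H1 H2]. apply Rle_trans with (2 := H2).
      apply Series_partial_le; [now apply weighted_nonneg | exact H1]. }
  assert (H : has_moment g y).
  { apply ex_series_bounded with C; [now apply weighted_nonneg | exact Hp]. }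
  split; [exact H |]. now apply Series_le_bound.
Qed.

(** Componentwise convergence is strong when the tails are uniformly small. *)
Lemma moment_tends_0 (g : nat -> R) (x : nat -> nat -> R) (y : nat -> R) :
  nonnegative g -> (forall j, tends (fun n => x n j) (y j)) ->
  (forall eps, 0 < eps -> exists f m, nonnegative f /\ (forall j, (m < j)%nat -> g j <= f j) /\
      forall n, has_moment f (x n) /\ moment f (x n) <= eps) ->
  tends (fun n => moment g (fun j => x n j - y j)) 0.
Proof.
  intros Hg Hlim Htail. apply tends_spec. intros eps He.
  destruct (Htail (eps / 4) ltac:(lra)) as [f [m [Hf [Hgf Hx]]]].
  destruct (moment_of_limit f x y _ Hf Hlim Hx) as [Hy By].
  assert (Hs : tends (fun n => sum_f_R0 (fun j => g j * Rabs (x n j - y j)) m) 0).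
  { replace 0 with (sum_f_R0 (fun j => g j * Rabs (y j - y j)) m).
    - apply (tends_sum (fun n j => g j * Rabs (x n j - y j))). intros j.
      apply tends_mult; [apply tends_const |]. apply tends_abs.
      apply tends_minus; [apply Hlim | apply tends_const].
    - apply sum_eq_R0. intros j _. rewrite Rminus_diag, Rabs_R0. ring. }
  apply tends_spec with (eps := eps / 4) in Hs; [| lra].
  apply filter_imp with (2 := Hs). intros n Hn. rewrite Rminus_0_r in *.
  destruct (Hx n) as [Hxn Bxn].
  destruct (moment_head_tail g f (fun j => x n j - y j) (x n) y m Hg Hf Hgf) as [Hd Bd];
    [| assumption | assumption |].
  { intros j. apply Rabs_minus_le. }
  rewrite Rabs_pos_eq by now apply moment_nonneg.
  apply Rle_lt_trans with (1 := Bd). apply Rabs_def2 in Hn. lra.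
Qed.

(** Truncating the rate at j + k <= n cuts the series of antidiagonal sums at n. *)
Lemma production_truncate_tends {A alpha : R} (S : collisions A alpha) (y : nat -> R) (i : nat) :
  (forall P, eventually P -> U P) -> has_moment INR y ->
  tends (fun n => production (truncate S n) y i) (production S y i).
Proof.
  intros HE Hy.
  set (t := fun j k => net S i j k * (y j * y k)).
  assert (E : forall n, production (truncate S n) y i = sum_f_R0 (diag t) n).
  { intros n. unfold production, double_series.
    assert (D : forall m, diag (fun j k => net (truncate S n) i j k * (y j * y k)) m
                = upto n (diag t) m).
    { intros m. unfold upto.
      destruct (Nat.leb_spec m n) as [Hm | Hm].
      - apply sum_eq. intros k Hk. unfold t, net. simpl. unfold truncated_rate.
        now rewrite (proj2 (Nat.leb_le _ _)) by lia.
      - apply sum_eq_R0. intros k Hk. unfold net. simpl. unfold truncated_rate.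
        rewrite (proj2 (Nat.leb_gt _ _)) by lia. ring. }
    rewrite (Series_ext _ _ D), (Series_finite _ n).
    - apply sum_eq. intros m Hm. unfold upto. now rewrite (proj2 (Nat.leb_le _ _) Hm).
    - intros m Hm. unfold upto. now rewrite (proj2 (Nat.leb_gt _ _) Hm). }
  destruct (net_summable S i y y Hy Hy) as [Hs _].
  assert (L := is_series_lim _ (double_summable_series _ Hs)).
  intros P HP. apply HE. apply (filter_imp (fun n => P (sum_f_R0 (diag t) n))).
  - intros n. now rewrite E.
  - exact (L P HP).
Qed.
End Limits.
Arguments tends U u l : clear implicits.

(** * Existence *)

Definition grid (h t : R) : nat := Z.to_nat (Int_part (t / h)).

Lemma grid_spec (h t : R) : 0 < h -> 0 <= t ->
  INR (grid h t) * h <= t < INR (grid h t) * h + h.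
Proof.
  intros Hh Ht. unfold grid.
  assert (hq : 0 <= t / h) by (apply Rmult_le_pos; [exact Ht | left; now apply Rinv_0_lt_compat]).
  destruct (base_Int_part (t / h)) as [B1 B2].
  assert (hz : (0 <= Int_part (t / h))%Z).
  { assert (h0 : -1 < IZR (Int_part (t / h))) by lra. apply lt_IZR in h0. lia. }
  rewrite INR_IZR_INZ, Z2Nat.id by exact hz.
  assert (e : t / h * h = t) by (field; lra).
  assert (h1 := Rmult_le_compat_r h _ _ ltac:(lra) B1).
  assert (h2 : t / h < IZR (Int_part (t / h)) + 1) by lra.
  apply (Rmult_lt_compat_r h) in h2; [| exact Hh]. lra.
Qed.

Lemma grid_le (h s t : R) : 0 < h -> 0 <= s <= t -> (grid h s <= grid h t)%nat.
Proof.
  intros Hh Hst. destruct (grid_spec h s) as [S1 _]; [lra | lra |].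
  destruct (grid_spec h t) as [_ T2]; [lra | lra |].
  assert (e : INR (grid h s) * h < (INR (grid h t) + 1) * h) by lra.
  apply Rmult_lt_reg_r in e; [| exact Hh]. rewrite <- S_INR in e.
  apply INR_lt in e. lia.
Qed.

(** The derivative is expressed by a first-order expansion, which is one-sided at the
endpoints and passes to limits without division. *)
Definition solves {A alpha : R} (S : collisions A alpha) (T : R) (w : R -> nat -> R) : Prop :=
  forall i t eps, (1 <= i)%nat -> 0 <= t <= T -> 0 < eps ->
  exists del, 0 < del /\ forall s, 0 <= s <= T -> Rabs (s - t) < del ->
    Rabs (w s i - w t i - (s - t) * production S (w t) i) <= eps * Rabs (s - t).

Definition path_continuous (g : nat -> R) (T : R) (w : R -> nat -> R) : Prop :=
  forall t eps, 0 <= t <= T -> 0 < eps ->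
  exists del, 0 < del /\ forall s, 0 <= s <= T -> Rabs (s - t) < del ->
    moment g (fun i => w s i - w t i) < eps.

Section Existence.
Context {A alpha : R} (S : collisions A alpha) (g y : nat -> R) (T : R).
Context (Hg : growth_weight g) (Hy : nonnegative y) (Hgy : has_moment g y) (HT : 0 <= T).

Let M := moment INR y.
Let kappa := A * (alpha + 2).
Let L := kappa * M ^ 2.

Let Hm : has_moment INR y.
Proof. eapply moment_le_weight; [apply INR_nonneg | apply Hg | exact Hgy]. Qed.

Let HM : 0 <= M.
Proof. apply moment_nonneg; [apply INR_nonneg | exact Hm]. Qed.

Let Hkappa : 0 <= kappa.
Proof. assert (h1 := A_nonneg S). assert (h2 := alpha_nonneg S). unfold kappa. nra. Qed.

Let HL : 0 <= L.
Proof. unfold L. apply Rmult_le_pos; [exact Hkappa | simpl; nra]. Qed.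

(** The step tends to 0 and is small enough for [euler_step_nonneg]. *)
Definition mesh (n : nat) : R := / ((1 + A * M) * INR (Datatypes.S n)).

Let mesh_pos (n : nat) : 0 < mesh n.
Proof.
  assert (hA := A_nonneg S). apply Rinv_0_lt_compat, Rmult_lt_0_compat; [nra |].
  apply lt_0_INR; lia.
Qed.

Let mesh_le (n : nat) : mesh n <= / INR (Datatypes.S n).
Proof.
  assert (hA := A_nonneg S). assert (hn : 0 < INR (Datatypes.S n)) by (apply lt_0_INR; lia).
  assert (hAM : 0 <= A * M) by nra.
  apply Rinv_le_contravar; [exact hn |]. rewrite <- (Rmult_1_l (INR _)) at 1.
  apply Rmult_le_compat_r; lra.
Qed.

Let mesh_stable (n : nat) : mesh n * (A * INR n * M) <= 1.
Proof.
  assert (hA := A_nonneg S). assert (hn : 0 <= INR n) by apply pos_INR.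
  assert (hAM : 0 <= A * M) by nra.
  assert (hd : 0 < (1 + A * M) * INR (Datatypes.S n)) by (rewrite S_INR; nra).
  unfold mesh. apply Rmult_le_reg_l with (1 := hd).
  rewrite <- Rmult_assoc, Rinv_r, Rmult_1_l, Rmult_1_r by lra. rewrite S_INR. nra.
Qed.

Let node (n r : nat) : nat -> R := euler S n (mesh n) y r.
Let approx (n : nat) (t : R) : nat -> R := node n (grid (mesh n) t).

Let node_invariants (n r : nat) :
  nonnegative (node n r) /\ has_moment INR (node n r) /\ moment INR (node n r) = M.
Proof.
  apply euler_invariants; [exact Hy | exact Hm | left; apply mesh_pos | apply mesh_stable].
Qed.

Definition tail_bound (m : nat) : R := exp (14 * A * M * T) * moment (tail_weight g m) y.

Let Htail (m : nat) : has_moment (tail_weight g m) y.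
Proof.
  eapply moment_le_weight; [apply (tail_weight_moderate g m Hg) | | exact Hgy].
  intros j. apply tail_weight_le, Hg.
Qed.

Let node_moderate (f : nat -> R) (n r : nat) :
  moderate f -> has_moment f y -> INR r * mesh n <= T ->
  has_moment f (node n r) /\ moment f (node n r) <= exp (14 * A * M * T) * moment f y.
Proof.
  intros Hf Hfy Hr.
  destruct (euler_moderate S f y n (mesh n) r Hf Hy) as [H1 H2];
    [left; apply mesh_pos | apply mesh_stable | exact Hm | exact Hfy |].
  split; [exact H1 |]. apply Rle_trans with (1 := H2).
  apply Rmult_le_compat_r; [apply moment_nonneg; [apply Hf | exact Hfy] |].
  apply exp_nondecreasing. apply Rmult_le_compat_l; [| exact Hr].
  assert (hA := A_nonneg S). fold M. nra.
Qed.

Let tail_bound_small (eps : R) : 0 < eps -> exists m, tail_bound m < eps.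
Proof.
  intros He. assert (hE := exp_pos (14 * A * M * T)).
  destruct (tail_weight_vanishes g y (eps / exp (14 * A * M * T)) Hg Hgy) as [m Hm'].
  { now apply Rdiv_lt_0_compat. }
  exists m. unfold tail_bound. apply (Rmult_lt_compat_l _ _ _ hE) in Hm'.
  replace (exp (14 * A * M * T) * (eps / exp (14 * A * M * T))) with eps in Hm' by (field; lra).
  exact Hm'.
Qed.

Let tail_bound_nonneg (m : nat) : 0 <= tail_bound m.
Proof.
  apply Rmult_le_pos; [left; apply exp_pos |].
  apply moment_nonneg; [apply (tail_weight_moderate g m Hg) | apply Htail].
Qed.

Let production_node (n r i : nat) : Rabs (production (truncate S n) (node n r) i) <= L.
Proof.
  destruct (node_invariants n r) as [_ [H1 H2]].
  unfold L. rewrite <- H2. now apply production_bound.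
Qed.

Let node_increment (n k l i : nat) : (k <= l)%nat ->
  Rabs (node n l i - node n k i) <= INR (l - k) * mesh n * L.
Proof.
  intros Hkl. assert (h := euler_increment S n (mesh n) y i k (l - k) 0 L).
  replace (k + (l - k))%nat with l in h by lia.
  rewrite Rmult_0_r, Rminus_0_r in h. apply h; [left; apply mesh_pos |].
  intros r _. rewrite Rminus_0_r. apply production_node.
Qed.

(** A modulus of continuity in time of the productions of all Euler schemes, at
time distance d: the components up to m move at speed at most [L], the others are
covered by the tail. For small d it is small once m is well chosen. *)
Definition modulus (m : nat) (d : R) : R :=
  2 * kappa * M * (sum_f_R0 g m * (d * L) + 2 * tail_bound m).

Let node_production (n k l r r0 i m : nat) :
  (k <= r <= l)%nat -> (k <= r0 <= l)%nat -> INR l * mesh n <= T ->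
  Rabs (production (truncate S n) (node n r) i - production (truncate S n) (node n r0) i)
  <= modulus m (INR (l - k) * mesh n).
Proof.
  intros Hr Hr0 Hl.
  destruct (node_invariants n r) as [_ [A1 A2]]. destruct (node_invariants n r0) as [_ [B1 B2]].
  eapply Rle_trans.
  { apply (production_lipschitz (truncate S n) _ _ i M A1 B1); lra. }
  unfold modulus. replace (2 * A * (alpha + 2) * M) with (2 * kappa * M) by (unfold kappa; ring).
  apply Rmult_le_compat_l; [nra |].
  assert (Hle : forall q, (q <= l)%nat -> INR q * mesh n <= T).
  { intros q Hq. apply le_INR in Hq. assert (hm := mesh_pos n). nra. }
  assert (Hmod := tail_weight_moderate g m Hg).
  destruct (node_moderate _ n r Hmod (Htail m) (Hle r ltac:(lia))) as [C1 C2].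
  destruct (node_moderate _ n r0 Hmod (Htail m) (Hle r0 ltac:(lia))) as [D1 D2].
  fold (tail_bound m) in C2, D2.
  destruct (moment_head_tail g (tail_weight g m) (fun j => node n r j - node n r0 j)
     (node n r) (node n r0) m) as [E1 E2]; try assumption; try apply Hg; try apply Hmod.
  { intros j Hj. rewrite tail_weight_eq by exact Hj. lra. }
  { intros j. apply Rabs_minus_le. }
  destruct (moment_le_weight INR g (fun j => node n r j - node n r0 j)) as [_ F2];
    [apply INR_nonneg | apply Hg | exact E1 |].
  apply Rle_trans with (1 := F2). apply Rle_trans with (1 := E2).
  assert (hs : sum_f_R0 (fun j => g j * Rabs (node n r j - node n r0 j)) m
               <= sum_f_R0 g m * (INR (l - k) * mesh n * L)).
  { rewrite (Rmult_comm (sum_f_R0 g m)), <- sum_scal_l. apply sum_Rle. intros j _.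
    rewrite Rmult_comm. apply Rmult_le_compat_r; [apply Hg |].
    assert (hmL : 0 <= mesh n * L) by (apply Rmult_le_pos; [left; apply mesh_pos | exact HL]).
    destruct (Nat.le_ge_cases r0 r) as [H | H].
    - apply Rle_trans with (1 := node_increment n r0 r j H).
      rewrite !Rmult_assoc. apply Rmult_le_compat_r; [exact hmL |]. apply le_INR; lia.
    - rewrite Rabs_minus_sym. apply Rle_trans with (1 := node_increment n r r0 j H).
      rewrite !Rmult_assoc. apply Rmult_le_compat_r; [exact hmL |]. apply le_INR; lia. }
  lra.
Qed.

(** Here d is the time between the grid points used for s and t; it differs from
t - s by at most one step. *)
Let approx_expansion (n i m : nat) (s t tau : R) :
  0 <= s <= tau -> tau <= t <= T ->
  let d := INR (grid (mesh n) t - grid (mesh n) s) * mesh n in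
  Rabs (approx n t i - approx n s i - d * production (truncate S n) (approx n tau) i)
  <= d * modulus m d.
Proof.
  intros H1 H2 d. assert (hm := mesh_pos n).
  set (k := grid (mesh n) s) in *. set (l := grid (mesh n) t) in *.
  set (r0 := grid (mesh n) tau).
  assert (Hk : (k <= r0)%nat) by (apply grid_le; lra).
  assert (Hl : (r0 <= l)%nat) by (apply grid_le; lra).
  assert (HlT : INR l * mesh n <= T).
  { destruct (grid_spec (mesh n) t) as [h _]; [lra | lra |]. fold l in h. lra. }
  assert (h := euler_increment S n (mesh n) y i k (l - k)
     (production (truncate S n) (node n r0) i) (modulus m d)).
  replace (k + (l - k))%nat with l in h by lia.
  apply h; [lra |]. intros r Hr. apply node_production; lia || exact HlT.
Qed.

(** The limits at different times are taken separately; the uniform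
expansion [approx_expansion] is what ties them together, both for the Lipschitz
bound and for the equation. *)
Lemma existence :
  exists w : R -> nat -> R,
    (forall i, w 0 i = y i) /\
    (forall t, 0 <= t <= T ->
       nonnegative (w t) /\ has_moment g (w t) /\ moment INR (w t) = moment INR y) /\
    path_continuous g T w /\ solves S T w.
Proof.
  destruct bounded_limits_along_ultrafilter as [U [HU [HE Hlim]]].
  assert (Hex : forall ti : R * nat, exists l,
     0 <= fst ti <= T -> tends U (fun n => approx n (fst ti) (snd ti)) l).
  { intros [t i]. simpl. destruct (Rle_dec 0 t) as [Ht0 | Ht0]; [| exists 0; lra].
    destruct (Rle_dec t T) as [HtT | HtT]; [| exists 0; lra].
    destruct (Hlim (fun n => approx n t i) (Rabs (y i) + T * L)) as [l Hl].
    - intros n. assert (hm := mesh_pos n).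
      assert (h := node_increment n 0 (grid (mesh n) t) i ltac:(lia)). rewrite Nat.sub_0_r in h.
      destruct (grid_spec (mesh n) t) as [h1 _]; [lra | lra |].
      change (node n 0 i) with (y i) in h. unfold approx.
      assert (h2 : INR (grid (mesh n) t) * mesh n * L <= T * L) by (apply Rmult_le_compat_r; lra).
      replace (node n (grid (mesh n) t) i)
        with (y i + (node n (grid (mesh n) t) i - y i)) by ring.
      apply Rle_trans with (1 := Rabs_triang _ _). lra.
    - exists l. intros _. exact Hl. }
  set (W := fun ti => proj1_sig (constructive_indefinite_description _ (Hex ti))).
  assert (HW : forall ti, 0 <= fst ti <= T -> tends U (fun n => approx n (fst ti) (snd ti)) (W ti))
    by (intros ti; exact (proj2_sig (constructive_indefinite_description _ (Hex ti)))).
  clearbody W.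
  set (w := fun t i => W (t, i)).
  assert (Hw : forall t, 0 <= t <= T -> forall i, tends U (fun n => approx n t i) (w t i)).
  { intros t Ht i. apply (HW (t, i)). exact Ht. }
  clearbody w. clear W HW Hex.
  assert (grid_T : forall n t, 0 <= t <= T -> INR (grid (mesh n) t) * mesh n <= T).
  { intros n t Ht. assert (hm := mesh_pos n).
    destruct (grid_spec (mesh n) t) as [h _]; [lra | lra | lra]. }
  assert (Happ : forall f t, moderate f -> has_moment f y -> 0 <= t <= T -> forall n,
     has_moment f (approx n t) /\ moment f (approx n t) <= exp (14 * A * M * T) * moment f y).
  { intros f t Hf Hfy Ht n. apply node_moderate; [exact Hf | exact Hfy | now apply grid_T]. }
  assert (Htl : forall t, 0 <= t <= T -> forall m,
     has_moment (tail_weight g m) (w t) /\ moment (tail_weight g m) (w t) <= tail_bound m).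
  { intros t Ht m. assert (Hmod := tail_weight_moderate g m Hg).
    apply (moment_of_limit (U := U) _ (fun n => approx n t)); [apply Hmod | now apply Hw |].
    now apply Happ. }
  assert (Hnn : forall t, 0 <= t <= T -> nonnegative (w t)).
  { intros t Ht i. apply (tends_le (U := U) (fun _ => 0) _ _ _ (tends_const 0) (Hw t Ht i)).
    intros n. now apply node_invariants. }
  assert (Hgw : forall t, 0 <= t <= T -> has_moment g (w t)).
  { intros t Ht. assert (Hmod := growth_weight_moderate g Hg).
    apply (moment_of_limit (U := U) g (fun n => approx n t) _
       (exp (14 * A * M * T) * moment g y)); [apply Hmod | now apply Hw |].
    now apply Happ. }
  assert (Hmw : forall t, 0 <= t <= T -> has_moment INR (w t)).
  { intros t Ht. eapply moment_le_weight; [apply INR_nonneg | apply Hg | now apply Hgw]. }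
  (* The tails are small uniformly in n, so componentwise convergence is strong. *)
  assert (Hdist : forall t, 0 <= t <= T ->
     tends U (fun n => moment INR (fun j => approx n t j - w t j)) 0).
  { intros t Ht. apply moment_tends_0; [apply INR_nonneg | now apply Hw |].
    intros eps He. destruct (tail_bound_small eps He) as [m Hm'].
    assert (Hmod := tail_weight_moderate g m Hg).
    exists (tail_weight g m), m. split; [apply Hmod |]. split.
    - intros j Hj. rewrite tail_weight_eq by exact Hj. apply Hg.
    - intros n. destruct (Happ _ t Hmod (Htail m) Ht n) as [h1 h2].
      split; [exact h1 |]. apply Rle_trans with (1 := h2). left; exact Hm'. }
  assert (Hmass : forall t, 0 <= t <= T -> moment INR (w t) = M).
  { intros t Ht.
    assert (h : Rabs (moment INR (w t) - M) <= 0).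
    { refine (tends_le (U := U) (fun _ => _) _ _ _ (tends_const _) (Hdist t Ht) _).
      intros n. destruct (node_invariants n (grid (mesh n) t)) as [_ [h1 h2]].
      fold (approx n t) in h1, h2.
      destruct (moment_minus INR _ _ INR_nonneg h1 (Hmw t Ht)) as [h3 _].
      destruct (moment_triangle INR (w t) (approx n t) (fun j => approx n t j - w t j)) as [_ h4];
        try assumption; [apply INR_nonneg | |].
      { intros j. replace (w t j) with (approx n t j - (approx n t j - w t j)) at 1 by ring.
        apply Rle_trans with (1 := Rabs_minus_le _ _). lra. }
      destruct (moment_triangle INR (approx n t) (w t) (fun j => approx n t j - w t j)) as [_ h5];
        [apply INR_nonneg | | now apply Hmw | assumption |].
      { intros j. replace (approx n t j) with (w t j + (approx n t j - w t j)) at 1 by ring.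
        apply Rabs_triang. }
      rewrite h2 in h4, h5. apply Rabs_le. lra. }
    destruct (Req_dec (moment INR (w t) - M) 0) as [E | E]; [lra |].
    apply Rabs_pos_lt in E. lra. }
  (* Both the truncation of the kernel and the argument vary with n; the Lipschitz
     constant of the truncated productions does not. *)
  assert (Hprod : forall t i, 0 <= t <= T ->
     tends U (fun n => production (truncate S n) (approx n t) i) (production S (w t) i)).
  { intros t i Ht.
    assert (H1 := production_truncate_tends S (w t) i HE (Hmw t Ht)).
    assert (H2 : tends U (fun n => production (truncate S n) (approx n t) i
                                   - production (truncate S n) (w t) i) 0).
    { apply tends_spec. intros eps He.
      assert (H3 : tends U (fun n => 2 * A * (alpha + 2) * M
                   * moment INR (fun j => approx n t j - w t j)) 0).
      { rewrite <- (Rmult_0_r (2 * A * (alpha + 2) * M)).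
        apply tends_mult; [apply tends_const | now apply Hdist]. }
      apply tends_spec with (eps := eps) in H3; [| exact He].
      apply filter_imp with (2 := H3). intros n Hn. rewrite Rminus_0_r in *.
      destruct (node_invariants n (grid (mesh n) t)) as [_ [h1 h2]].
      eapply Rle_lt_trans; [| apply Rle_lt_trans with (1 := Rle_abs _) (2 := Hn)].
      apply production_lipschitz; [exact h1 | now apply Hmw | | rewrite Hmass by exact Ht; lra].
      unfold approx. rewrite h2. lra. }
    assert (H4 := tends_plus _ _ _ _ H1 H2). rewrite Rplus_0_r in H4.
    apply filterlim_ext with (2 := H4). intros n. ring. }
  assert (Hspan : forall s t, 0 <= s <= t -> t <= T ->
     tends U (fun n => INR (grid (mesh n) t - grid (mesh n) s) * mesh n) (t - s)).
  { intros s t Hs Ht. apply tends_spec. intros eps He. apply HE.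
    destruct (nfloor_ex (/ eps)) as [n0 [_ Hn0]]; [left; now apply Rinv_0_lt_compat |].
    exists n0. intros n Hn. assert (hm := mesh_pos n).
    rewrite minus_INR by (apply grid_le; lra).
    destruct (grid_spec (mesh n) s) as [a1 a2]; [lra | lra |].
    destruct (grid_spec (mesh n) t) as [b1 b2]; [lra | lra |].
    assert (hsmall : mesh n < eps).
    { apply Rle_lt_trans with (1 := mesh_le n). rewrite <- (Rinv_inv eps).
      apply Rinv_lt_contravar.
      - apply Rmult_lt_0_compat; [now apply Rinv_0_lt_compat | apply lt_0_INR; lia].
      - apply Rlt_le_trans with (1 := Hn0). rewrite <- S_INR. apply le_INR. lia. }
    apply Rabs_def1; lra. }
  (* Used below with tau = s and with tau = t, for increments on either side. *)
  assert (Hexp : forall s t tau i m, 0 <= s <= tau -> tau <= t <= T ->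
     Rabs (w t i - w s i - (t - s) * production S (w tau) i) <= (t - s) * modulus m (t - s)).
  { intros s t tau i m Hs Ht.
    assert (Hd := Hspan s t ltac:(lra) ltac:(lra)).
    eapply (tends_le (U := U)); [| | intros n; exact (approx_expansion n i m s t tau Hs Ht)].
    - apply tends_abs. apply tends_minus.
      + apply tends_minus; apply Hw; lra.
      + apply tends_mult; [exact Hd | apply Hprod; lra].
    - apply tends_mult; [exact Hd |]. unfold modulus.
      apply tends_mult; [apply tends_const |]. apply tends_plus; [| apply tends_const].
      apply tends_mult; [apply tends_const |]. apply tends_mult; [exact Hd | apply tends_const]. }
  assert (Hlip : forall s t i, 0 <= s <= T -> 0 <= t <= T -> Rabs (w t i - w s i) <= Rabs (t - s) * L).
  { assert (W : forall s t i, 0 <= s <= t -> t <= T -> Rabs (w t i - w s i) <= (t - s) * L).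
    { intros s t i Hs Ht.
      eapply (tends_le (U := U)); [| | intros n;
        exact (node_increment n (grid (mesh n) s) (grid (mesh n) t) i
                 (grid_le _ _ _ (mesh_pos n) Hs))].
      - apply tends_abs, tends_minus; apply Hw; lra.
      - apply tends_mult; [now apply Hspan | apply tends_const]. }
    intros s t i Hs Ht. destruct (Rle_dec s t) as [H | H].
    - rewrite (Rabs_pos_eq (t - s)) by lra. apply W; lra.
    - rewrite Rabs_minus_sym, (Rabs_minus_sym t s), (Rabs_pos_eq (s - t)) by lra. apply W; lra. }
  exists w. split; [| split; [| split]].
  - intros i. apply (tends_unique (U := U) (fun n => approx n 0 i)); [apply Hw; lra |].
    apply filterlim_ext with (fun _ : nat => y i); [| apply tends_const].
    intros n. unfold approx, grid, Rdiv. rewrite Rmult_0_l.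
    replace (Int_part 0) with 0%Z; [reflexivity |].
    apply Int_part_spec. lra.
  - intros t Ht. split; [now apply Hnn |]. split; [now apply Hgw | now apply Hmass].
  - intros t eps Ht He.
    destruct (tail_bound_small (eps / 4) ltac:(lra)) as [m Hm'].
    assert (hG : 0 <= sum_f_R0 g m) by (apply cond_pos_sum; apply Hg).
    assert (hX : 0 < 1 + sum_f_R0 g m * L) by nra.
    exists (eps / 4 / (1 + sum_f_R0 g m * L)).
    split; [apply Rdiv_lt_0_compat; lra |]. intros s Hs Hst.
    assert (Hmod := tail_weight_moderate g m Hg).
    destruct (Htl s Hs m) as [C1 C2]. destruct (Htl t Ht m) as [D1 D2].
    destruct (moment_head_tail g (tail_weight g m) (fun j => w s j - w t j) (w s) (w t) m)
      as [E1 E2]; try assumption; try apply Hg; try apply Hmod.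
    { intros j Hj. rewrite tail_weight_eq by exact Hj. lra. }
    { intros j. apply Rabs_minus_le. }
    apply Rle_lt_trans with (1 := E2).
    assert (hs : sum_f_R0 (fun j => g j * Rabs (w s j - w t j)) m
                 <= sum_f_R0 g m * L * Rabs (s - t)).
    { replace (sum_f_R0 g m * L * Rabs (s - t)) with ((Rabs (s - t) * L) * sum_f_R0 g m) by ring.
      rewrite <- sum_scal_l. apply sum_Rle. intros j _.
      rewrite Rmult_comm. apply Rmult_le_compat_r; [apply Hg | now apply Hlip]. }
    apply (Rmult_lt_compat_r _ _ _ hX) in Hst.
    replace (eps / 4 / (1 + sum_f_R0 g m * L) * (1 + sum_f_R0 g m * L)) with (eps / 4) in Hst
      by (field; lra).
    assert (hst := Rabs_pos (s - t)). lra.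
  - intros i t eps _ Ht He.
    set (K := 2 * kappa * M). assert (hK : 0 <= K) by (unfold K; nra).
    destruct (tail_bound_small (eps / (4 * (1 + K)))) as [m Hm'].
    { apply Rdiv_lt_0_compat; lra. }
    assert (hG : 0 <= sum_f_R0 g m) by (apply cond_pos_sum; apply Hg).
    assert (hX : 0 < 1 + sum_f_R0 g m * L) by nra.
    (* m makes the tail part of the modulus at most eps/2, then del the other part. *)
    set (del := eps / (2 * (1 + K) * (1 + sum_f_R0 g m * L))).
    assert (hdel : 0 < del) by (apply Rdiv_lt_0_compat; nra).
    assert (Hmodulus : forall d, 0 <= d < del -> modulus m d <= eps).
    { intros d Hd. unfold modulus. fold K.
      assert (e1 : sum_f_R0 g m * (d * L) <= eps / (2 * (1 + K))).
      { apply Rle_trans with (del * (1 + sum_f_R0 g m * L)).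
        - assert (0 <= sum_f_R0 g m * L) by nra. nra.
        - unfold del. right. field. split; lra. }
      assert (e2 : 2 * tail_bound m <= eps / (2 * (1 + K))).
      { replace (eps / (2 * (1 + K))) with (2 * (eps / (4 * (1 + K)))) by (field; lra). lra. }
      apply Rle_trans with ((1 + K) * (eps / (2 * (1 + K)) + eps / (2 * (1 + K)))).
      - assert (h0 := tail_bound_nonneg m).
        assert (h1 : 0 <= sum_f_R0 g m * (d * L)) by (apply Rmult_le_pos; [exact hG | nra]).
        apply Rmult_le_compat; lra.
      - right. field. lra. }
    exists del. split; [exact hdel |]. intros s Hs Hst.
    assert (hst := Rabs_pos (s - t)).
    assert (hmod := Hmodulus (Rabs (s - t)) (conj hst Hst)).
    apply Rle_trans with (Rabs (s - t) * modulus m (Rabs (s - t)));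
      [| rewrite (Rmult_comm eps); now apply Rmult_le_compat_l].
    destruct (Rle_dec t s) as [H | H].
    + rewrite (Rabs_pos_eq (s - t)) by lra. apply Hexp; lra.
    + rewrite (Rabs_minus_sym s t), (Rabs_pos_eq (t - s)) by lra.
      rewrite <- Rabs_Ropp.
      replace (- _) with (w t i - w s i - (t - s) * production S (w t) i) by ring.
      apply Hexp; lra.
Qed.
End Existence.

(** * Real induction and continuous paths *)

(** The supremum of the c for which Q holds on [0,c] is T. *)
Lemma real_induction (T : R) (Q : R -> Prop) :
  Q 0 ->
  (forall t, 0 < t <= T -> (forall s, 0 <= s < t -> Q s) -> Q t) ->
  (forall t, 0 <= t < T -> Q t ->
     exists del, 0 < del /\ forall s, t < s < t + del -> s <= T -> Q s) ->
  forall t, 0 <= t <= T -> Q t.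
Proof.
  intros Q0 Qleft Qright t Ht.
  destruct (completeness (fun c => 0 <= c <= T /\ forall s, 0 <= s <= c -> Q s)) as [c [Hub Hlub]].
  - exists T. intros c [Hc _]. lra.
  - exists 0. split; [lra |]. intros s Hs. replace s with 0 by lra. exact Q0.
  - assert (c0 : 0 <= c).
    { apply Hub. split; [lra |]. intros s Hs. replace s with 0 by lra. exact Q0. }
    assert (cT : c <= T) by (apply Hlub; intros x [Hx _]; lra).
    assert (Hbelow : forall s, 0 <= s < c -> Q s).
    { intros s Hs. apply Classical_Prop.NNPP; intros Hn.
      assert (c <= s); [| lra]. apply Hlub. intros x [_ Hx].
      apply Rnot_lt_le; intros Hlt. apply Hn, Hx. lra. }
    assert (Hc : Q c).
    { destruct (Req_dec c 0) as [-> | E]; [exact Q0 |]. apply Qleft; [lra | exact Hbelow]. }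
    destruct (Rlt_le_dec c T) as [H | H].
    + exfalso. destruct (Qright c (conj c0 H) Hc) as [del [Hd Hs]].
      set (x := Rmin (c + del / 2) T).
      assert (x <= c + del / 2) by apply Rmin_l. assert (x <= T) by apply Rmin_r.
      assert (c < x) by (apply Rmin_glb_lt; lra).
      assert (x <= c); [| lra]. apply Hub. split; [lra |]. intros s Hsx.
      destruct (Rtotal_order s c) as [h | [-> | h]]; [apply Hbelow; lra | exact Hc | apply Hs; lra].
    + destruct (Rtotal_order t c) as [h | [-> | h]]; [apply Hbelow; lra | exact Hc | lra].
Qed.

(** Compactness of [0,T], for properties monotone in a parameter. *)
Lemma locally_bounded_uniform (T : R) (P : nat -> R -> Prop) :
  (forall m n t, (m <= n)%nat -> P m t -> P n t) ->
  (forall t, 0 <= t <= T -> exists del n, 0 < del /\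
     forall s, 0 <= s <= T -> Rabs (s - t) < del -> P n s) ->
  0 <= T -> exists n, forall t, 0 <= t <= T -> P n t.
Proof.
  intros Hmono Hloc HT.
  assert (H : forall t, 0 <= t <= T -> exists n, forall s, 0 <= s <= t -> P n s).
  { apply real_induction.
    - destruct (Hloc 0 ltac:(lra)) as [del [n [Hd Hn]]]. exists n. intros s Hs.
      replace s with 0 by lra. apply Hn; [lra |]. rewrite Rminus_0_r, Rabs_R0. exact Hd.
    - intros t Ht Hbelow. destruct (Hloc t ltac:(lra)) as [del [n [Hd Hn]]].
      destruct (Hbelow (Rmax 0 (t - del / 2))) as [m Hm].
      { split; [apply Rmax_l | apply Rmax_lub_lt; lra]. }
      exists (Nat.max m n). intros s Hs.
      destruct (Rle_dec s (t - del / 2)) as [h | h].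
      + apply (Hmono m); [lia |]. apply Hm. split; [lra |].
        apply Rle_trans with (1 := h), Rmax_r.
      + apply (Hmono n); [lia |]. apply Hn; [lra |]. apply Rabs_def1; lra.
    - intros t Ht [m Hm]. destruct (Hloc t ltac:(lra)) as [del [n [Hd Hn]]].
      exists del. split; [exact Hd |]. intros s Hs HsT. exists (Nat.max m n). intros x Hx.
      destruct (Rle_dec x t) as [h | h].
      + apply (Hmono m); [lia |]. apply Hm. lra.
      + apply (Hmono n); [lia |]. apply Hn; [lra |]. apply Rabs_def1; lra. }
  destruct (H T ltac:(lra)) as [n Hn]. exists n. exact Hn.
Qed.

(** A comparison principle that needs no derivative of f, so that sums of absolute
values are allowed. *)
Lemma nonincreasing_by_dini (T : R) (f : R -> R) :
  (forall t eps, 0 < t <= T -> 0 < eps -> exists del, 0 < del /\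
     forall s, 0 <= s < t -> t - s < del -> f t <= f s + eps) ->
  (forall t, 0 <= t < T -> exists del, 0 < del /\
     forall s, t < s < t + del -> s <= T -> f s <= f t) ->
  forall t, 0 <= t <= T -> f t <= f 0.
Proof.
  intros Hleft Hright. apply real_induction.
  - lra.
  - intros t Ht Hbelow. apply le_epsilon. intros eps He.
    destruct (Hleft t eps Ht He) as [del [Hd Hs]].
    set (s := Rmax 0 (t - del / 2)).
    assert (0 <= s) by apply Rmax_l. assert (t - del / 2 <= s) by apply Rmax_r.
    assert (s < t) by (apply Rmax_lub_lt; lra).
    assert (h := Hs s ltac:(lra) ltac:(lra)). assert (h' := Hbelow s ltac:(lra)). lra.
  - intros t Ht Hft. destruct (Hright t Ht) as [del [Hd Hs]].
    exists del. split; [exact Hd |]. intros s H1 H2. specialize (Hs s H1 H2). lra.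
Qed.

Section Paths.
Context (g : nat -> R) (T : R) (w : R -> nat -> R) (HT : 0 <= T) (Hg : nonnegative g)
  (Hw : forall t, 0 <= t <= T -> has_moment g (w t)) (Hc : path_continuous g T w).

Let close (t s : R) (f : nat -> R) (Hf : nonnegative f) (Hfg : forall j, f j <= g j)
  (Ht : 0 <= t <= T) (Hs : 0 <= s <= T) :
  moment f (w s) <= moment f (w t) + moment g (fun i => w s i - w t i).
Proof.
  destruct (moment_minus g (w s) (w t) Hg (Hw s Hs) (Hw t Ht)) as [Hd _].
  destruct (moment_le_weight f g _ Hf Hfg (Hw t Ht)) as [H1 _].
  destruct (moment_le_weight f g _ Hf Hfg Hd) as [H2 H3].
  destruct (moment_triangle f (w s) (w t) (fun i => w s i - w t i)) as [_ H4];
    [exact Hf | | exact H1 | exact H2 | lra].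
  intros j. replace (w s j) with (w t j + (w s j - w t j)) at 1 by ring. apply Rabs_triang.
Qed.

Lemma path_bounded : exists B, forall t, 0 <= t <= T -> moment g (w t) <= B.
Proof.
  destruct (locally_bounded_uniform T (fun n t => moment g (w t) <= INR n)) as [n Hn].
  - intros m n t Hmn H. apply le_INR in Hmn. lra.
  - intros t Ht. destruct (Hc t 1 Ht ltac:(lra)) as [del [Hd Hs]].
    destruct (nfloor_ex (moment g (w t) + 1)) as [n [_ Hn]].
    { assert (h := moment_nonneg _ _ Hg (Hw t Ht)). lra. }
    exists del, (S n). split; [exact Hd |]. intros s Hs1 Hs2.
    specialize (Hs s Hs1 Hs2). rewrite S_INR.
    assert (h := close t s g Hg (fun j => Rle_refl _) Ht Hs1). lra.
  - exact HT.
  - exists (INR n). exact Hn.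
Qed.

(** Pointwise tails are small by summability, and continuity in the norm carries an
estimate at t to the times near t; compactness makes it uniform. *)
Lemma path_uniform_tails (eps : R) : 0 < eps ->
  exists n, forall m t, (n <= m)%nat -> 0 <= t <= T -> moment (beyond m g) (w t) <= eps.
Proof.
  intros He.
  destruct (locally_bounded_uniform T
    (fun n t => forall m, (n <= m)%nat -> 0 <= t <= T -> moment (beyond m g) (w t) <= eps))
    as [n Hn].
  - intros m n t Hmn H p Hp Ht. apply H; [lia | exact Ht].
  - intros t Ht. destruct (Hc t (eps / 2) Ht ltac:(lra)) as [del [Hd Hs]].
    destruct (beyond_vanishes g (w t) (eps / 2) Hg (Hw t Ht) ltac:(lra)) as [n Hn].
    exists del, n. split; [exact Hd |]. intros s Hs1 Hs2 m Hm _.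
    specialize (Hs s Hs1 Hs2). specialize (Hn m Hm).
    assert (h := close t s _ (beyond_nonneg m g Hg) (beyond_le m g Hg) Ht Hs1). lra.
  - exact HT.
  - exists n. intros m t Hm Ht. now apply Hn.
Qed.
End Paths.

(** * Uniqueness *)

(** A sign of e. At e = 0 it is the sign of the velocity f, so that [orientation e f]
times f is always the right derivative of |e + h f| at h = 0. *)
Definition orientation (e f : R) : R :=
  if Rlt_dec 0 e then 1 else if Rlt_dec e 0 then -1 else if Rle_dec 0 f then 1 else -1.

Lemma orientation_abs (e f : R) : Rabs (orientation e f) <= 1 /\ orientation e f * e = Rabs e.
Proof.
  unfold orientation.
  destruct (Rlt_dec 0 e); [rewrite Rabs_R1, Rabs_pos_eq; lra |].
  destruct (Rlt_dec e 0).
  - rewrite (Rabs_left e), Rabs_left; lra.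
  - replace e with 0 by lra. rewrite Rabs_R0.
    destruct (Rle_dec 0 f); [rewrite Rabs_R1 | rewrite Rabs_left]; lra.
Qed.

Lemma orientation_derivative (e f : R) : exists del, 0 < del /\
  forall h, 0 <= h < del -> Rabs (e + h * f) = Rabs e + h * (orientation e f * f).
Proof.
  unfold orientation. assert (hf := Rabs_pos f). assert (hf1 := Rle_abs f).
  assert (hf2 := Rcomplements.Rabs_maj2 f).
  assert (W : forall x, 0 < x -> 0 < x / (1 + Rabs f) /\
    forall h, 0 <= h < x / (1 + Rabs f) -> h * Rabs f < x).
  { intros x Hx. assert (h0 : 0 < x / (1 + Rabs f)) by (apply Rdiv_lt_0_compat; lra).
    split; [exact h0 |]. intros h Hh.
    assert (e1 : x / (1 + Rabs f) * (1 + Rabs f) = x) by (field; lra). nra. }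
  destruct (Rlt_dec 0 e) as [H1 | H1].
  - destruct (W e H1) as [W1 W2]. exists (e / (1 + Rabs f)). split; [exact W1 |].
    intros h Hh. specialize (W2 h Hh). rewrite (Rabs_pos_eq e), Rabs_pos_eq; nra.
  - destruct (Rlt_dec e 0) as [H2 | H2].
    + destruct (W (- e) ltac:(lra)) as [W1 W2]. exists (- e / (1 + Rabs f)). split; [exact W1 |].
      intros h Hh. specialize (W2 h Hh). rewrite (Rabs_left e), Rabs_left; nra.
    + exists 1. split; [lra |]. intros h Hh. replace e with 0 by lra.
      rewrite Rabs_R0, !Rplus_0_l, Rabs_mult, (Rabs_pos_eq h) by lra.
      destruct (Rle_dec 0 f) as [h1 | h1]; [rewrite Rabs_pos_eq | rewrite Rabs_left]; lra.
Qed.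

Section Contraction.
Context {A alpha : R} (S : collisions A alpha) (g : nat -> R) (K : R)
  (HgI : forall j, INR j <= g j)
  (HK : forall j k, INR k * rate S j k <= K * (INR j * g k)) (HK0 : 0 <= K).

Let Hg : nonnegative g.
Proof. intros j. apply Rle_trans with (2 := HgI j), pos_INR. Qed.

(** With signs of modulus at most 1 the outcome counts for at most j + k and the loss
of k for at most k, while the loss of j counts for exactly -j, since sigma j is
the sign of e. The sum 2 k is controlled by [HK]; the loss of j is missing when
j > n, which costs the term with [beyond]. *)
Lemma transfer_signed (sigma : nat -> R) (n j k : nat) (e : R) :
  (forall i, Rabs (sigma i) <= 1) -> sigma j * e = Rabs e ->
  transfer S (fun i => INR i * sigma i) n j k * e
  <= K * ((INR j * Rabs e + beyond n g j * Rabs e) * g k).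
Proof.
  intros Hs He.
  assert (he := Rabs_pos e). assert (hj := pos_INR j). assert (hk := pos_INR k).
  assert (hb := beyond_nonneg n g Hg j). assert (gk := Hg k).
  assert (rhs0 : 0 <= (INR j * Rabs e + beyond n g j * Rabs e) * g k).
  { apply Rmult_le_pos; [| exact gk]. apply Rplus_le_le_0_compat; now apply Rmult_le_pos. }
  assert (rhs : 0 <= K * ((INR j * Rabs e + beyond n g j * Rabs e) * g k))
    by now apply Rmult_le_pos.
  unfold transfer.
  destruct (Nat.eq_dec j 0) as [-> | Hj]; [rewrite rate_0; lra |].
  destruct (Nat.eq_dec k 0) as [-> | Hk]; [rewrite (rate_r0 S); lra |].
  set (sum := sum_f_R0 (fun i => INR i * sigma i * yield S i j k) n).
  assert (Hsum : Rabs sum <= INR j + INR k).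
  { rewrite <- (yield_mass _ _ S j k) by lia.
    assert (pos : forall i, 0 <= INR i * yield S i j k).
    { intros i. apply Rmult_le_pos; [apply pos_INR | apply yield_nonneg]. }
    apply Rle_trans with (sum_f_R0 (fun i => INR i * yield S i j k) n).
    - apply Rle_trans with (1 := Rsum_abs _ _). apply sum_Rle. intros i _.
      rewrite !Rabs_mult, (Rabs_pos_eq (INR i)) by apply pos_INR.
      rewrite (Rabs_pos_eq (yield S i j k)) by apply yield_nonneg.
      rewrite Rmult_assoc, (Rmult_comm (Rabs _)), <- Rmult_assoc.
      rewrite <- (Rmult_1_r (INR i * yield S i j k)) at 2.
      now apply Rmult_le_compat_l.
    - destruct (Nat.le_ge_cases n (j + k)) as [h | h].
      + assert (hx : forall m, (n <= m)%nat -> sum_f_R0 (fun i => INR i * yield S i j k) n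
                     <= sum_f_R0 (fun i => INR i * yield S i j k) m).
        { intros m Hm. induction Hm as [| m Hm IH]; [lra |]. rewrite tech5.
          specialize (pos (Datatypes.S m)). lra. }
        now apply hx.
      + rewrite (sum_extend _ (j + k) n h); [lra |].
        intros i Hi. rewrite (yield_large _ _ S i j k Hi). ring. }
  assert (h1 : sum * e <= (INR j + INR k) * Rabs e).
  { apply Rle_trans with (1 := Rle_abs _). rewrite Rabs_mult. now apply Rmult_le_compat_r. }
  assert (h2 : - (upto n (fun i => INR i * sigma i) k * e) <= INR k * Rabs e).
  { apply Rle_trans with (1 := Rcomplements.Rabs_maj2 _). rewrite Rabs_mult.
    apply Rmult_le_compat_r; [exact he |]. unfold upto. destruct Nat.leb.
    - rewrite Rabs_mult, Rabs_pos_eq by exact hk. rewrite <- (Rmult_1_r (INR k)) at 2.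
      now apply Rmult_le_compat_l.
    - now rewrite Rabs_R0. }
  assert (hr := rate_nonneg _ _ S j k).
  assert (r1 := HK j k). assert (r2 := HK k j). rewrite (rate_sym _ _ S k j) in r2.
  assert (h3 : (sum - upto n (fun i => INR i * sigma i) j - upto n (fun i => INR i * sigma i) k) * e
     <= (2 * INR k + (if Nat.leb j n then 0 else INR j)) * Rabs e).
  { unfold upto at 1. destruct (Nat.leb j n); [| lra].
    assert (INR j * sigma j * e = INR j * Rabs e) by (rewrite <- He; ring). lra. }
  rewrite Rmult_assoc.
  apply Rle_trans with (/ 2 * rate S j k * ((2 * INR k + (if Nat.leb j n then 0 else INR j)) * Rabs e)).
  { apply Rmult_le_compat_l; [lra | exact h3]. }
  unfold beyond in *. assert (gj := HgI j). assert (gk' := HgI k).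
  assert (r1' := Rmult_le_compat_r _ _ _ he r1).
  destruct (Nat.leb j n); [lra |].
  assert (r3 : INR j * rate S j k <= K * (g j * g k)).
  { apply Rle_trans with (1 := r2). apply Rmult_le_compat_l; [exact HK0 |].
    rewrite Rmult_comm. now apply Rmult_le_compat_l. }
  assert (r3' := Rmult_le_compat_r _ _ _ he r3).
  assert (0 <= K * (g j * g k) * Rabs e).
  { apply Rmult_le_pos; [| exact he]. apply Rmult_le_pos; [exact HK0 |]. now apply Rmult_le_pos. }
  lra.
Qed.

(** Symmetrised polarisation: with e = y - z and s = y + z one has
y_j y_k - z_j z_k = (e_j s_k + s_j e_k)/2, and [transfer_signed] applies to both terms. *)
Lemma signed_production_difference (y z sigma : nat -> R) (n : nat) :
  nonnegative y -> nonnegative z -> has_moment g y -> has_moment g z ->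
  (forall i, Rabs (sigma i) <= 1) -> (forall i, sigma i * (y i - z i) = Rabs (y i - z i)) ->
  sum_f_R0 (fun i => INR i * sigma i * (production S y i - production S z i)) n
  <= K * ((moment INR (fun i => y i - z i) + moment (beyond n g) (fun i => y i - z i))
          * (moment g y + moment g z)).
Proof.
  intros Hy Hz My Mz Hs He.
  assert (Iy : has_moment INR y) by (eapply moment_le_weight; [apply INR_nonneg | exact HgI | exact My]).
  assert (Iz : has_moment INR z) by (eapply moment_le_weight; [apply INR_nonneg | exact HgI | exact Mz]).
  destruct (moment_minus g y z Hg My Mz) as [Md _].
  destruct (moment_minus INR y z INR_nonneg Iy Iz) as [Id _].
  destruct (moment_beyond n g _ Hg Md) as [Bd _].
  destruct (weak_form S (fun i => INR i * sigma i) y n Iy) as [Wy Ey].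
  destruct (weak_form S (fun i => INR i * sigma i) z n Iz) as [Wz Ez].
  replace (sum_f_R0 _ n) with
    (double_series (fun j k => transfer S (fun i => INR i * sigma i) n j k * (y j * y k)
       - transfer S (fun i => INR i * sigma i) n j k * (z j * z k))).
  2:{ rewrite double_series_minus, <- Ey, <- Ez by assumption.
      rewrite <- minus_sum. apply sum_eq. intros; ring. }
  set (b := transfer S (fun i => INR i * sigma i) n) in *.
  set (x := fun j => INR j * Rabs (y j - z j) + beyond n g j * Rabs (y j - z j)).
  set (q := fun k => g k * Rabs (y k) + g k * Rabs (z k)).
  assert (Sx : ex_series x) by (apply (ex_series_plus (V := R_NormedModule)); [exact Id | exact Bd]).
  assert (Sq : ex_series q) by (apply (ex_series_plus (V := R_NormedModule)); [exact My | exact Mz]).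
  assert (Px : forall j, 0 <= x j).
  { intros j. assert (h := Rabs_pos (y j - z j)). assert (h1 := pos_INR j).
    assert (h2 := beyond_nonneg n g Hg j). unfold x.
    apply Rplus_le_le_0_compat; now apply Rmult_le_pos. }
  assert (Pq : forall k, 0 <= q k).
  { intros k. unfold q. assert (h := Hg k). assert (h1 := Rabs_pos (y k)).
    assert (h2 := Rabs_pos (z k)). apply Rplus_le_le_0_compat; now apply Rmult_le_pos. }
  destruct (double_series_product x q Px Pq Sx Sq) as [P1 P2].
  set (p := fun j k => x j * q k) in *.
  assert (EX : Series x = moment INR (fun i => y i - z i) + moment (beyond n g) (fun i => y i - z i)).
  { unfold x. now rewrite Series_plus. }
  assert (EQ : Series q = moment g y + moment g z).
  { unfold q. now rewrite Series_plus. }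
  rewrite <- EX, <- EQ, <- P2.
  replace (K * double_series p) with (double_series (fun j k => K / 2 * p j k + K / 2 * p k j)).
  2:{ rewrite double_series_plus;
        try (apply double_summable_scal; (exact P1 || now apply double_summable_swap)).
      rewrite (double_series_scal _ (fun j k => p k j)), (double_series_scal _ p),
        (double_series_swap p). field. }
  apply double_series_le.
  - intros j k.
    assert (hb : b j k = b k j) by apply transfer_sym.
    assert (hjk := transfer_signed sigma n j k (y j - z j) Hs (He j)).
    assert (hkj := transfer_signed sigma n k j (y k - z k) Hs (He k)).
    fold (b j k) in hjk. fold (b k j) in hkj. rewrite <- hb in hkj. fold (x j) in hjk. fold (x k) in hkj.
    assert (sj : 0 <= y j + z j) by (apply Rplus_le_le_0_compat; auto).
    assert (sk : 0 <= y k + z k) by (apply Rplus_le_le_0_compat; auto).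
    apply (Rmult_le_compat_r _ _ _ sk) in hjk. apply (Rmult_le_compat_r _ _ _ sj) in hkj.
    unfold p, q. rewrite (Rabs_pos_eq (y j)), (Rabs_pos_eq (z j)), (Rabs_pos_eq (y k)),
      (Rabs_pos_eq (z k)) by auto.
    lra.
  - apply double_summable_plus; [exact Wy |].
    apply ex_series_ext with (2 := Wz). intros m. apply diag_ext. intros j k. now rewrite Rabs_Ropp.
  - apply double_summable_plus; apply double_summable_scal; [exact P1 |].
    now apply double_summable_swap.
Qed.

Context (T : R) (HT : 0 <= T) (u v : R -> nat -> R)
  (Hu : forall t, 0 <= t <= T -> nonnegative (u t) /\ has_moment g (u t))
  (Hv : forall t, 0 <= t <= T -> nonnegative (v t) /\ has_moment g (v t))
  (Cu : path_continuous g T u) (Cv : path_continuous g T v)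
  (Su : solves S T u) (Sv : solves S T v)
  (H0 : forall i, (1 <= i)%nat -> u 0 i = v 0 i).

Let e (t : R) (i : nat) : R := u t i - v t i.
Let head (n : nat) (t : R) : R := sum_f_R0 (fun i => INR i * Rabs (e t i)) n.
Let sigma (t : R) (i : nat) : R :=
  orientation (e t i) (production S (u t) i - production S (v t) i).

(** The upper right derivative of the partial sum of i |e_i|. *)
Let head_derivative (n : nat) (t eta : R) : 0 <= t < T -> 0 < eta ->
  exists del, 0 < del /\ forall s, t < s < t + del -> s <= T ->
    head n s <= head n t + (s - t) *
      (sum_f_R0 (fun i => INR i * sigma t i * (production S (u t) i - production S (v t) i)) n + eta).
Proof.
  intros Ht. revert eta. induction n as [| n IH]; intros eta Heta.
  - exists 1. split; [lra |]. intros s Hs _. unfold head. simpl. nra.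
  - destruct (IH (eta / 2) ltac:(lra)) as [d1 [Hd1 IHs]].
    set (i := Datatypes.S n) in *.
    assert (hi : 0 < INR i) by (apply lt_0_INR; lia).
    set (eps := eta / (4 * INR i)).
    assert (heps : 0 < eps) by (apply Rdiv_lt_0_compat; lra).
    destruct (Su i t eps ltac:(lia) ltac:(lra) heps) as [d2 [Hd2 Us]].
    destruct (Sv i t eps ltac:(lia) ltac:(lra) heps) as [d3 [Hd3 Vs]].
    set (f := production S (u t) i - production S (v t) i) in *.
    destruct (orientation_derivative (e t i) f) as [d4 [Hd4 Os]].
    exists (Rmin (Rmin d1 d2) (Rmin d3 d4)).
    assert (m1 := Rmin_l (Rmin d1 d2) (Rmin d3 d4)). assert (m2 := Rmin_r (Rmin d1 d2) (Rmin d3 d4)).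
    assert (m3 := Rmin_l d1 d2). assert (m4 := Rmin_r d1 d2).
    assert (m5 := Rmin_l d3 d4). assert (m6 := Rmin_r d3 d4).
    split; [repeat apply Rmin_glb_lt; assumption |]. intros s Hs HsT.
    specialize (IHs s ltac:(lra) HsT).
    assert (hst : Rabs (s - t) = s - t) by (apply Rabs_pos_eq; lra).
    assert (U1 := Us s ltac:(lra) ltac:(rewrite hst; lra)).
    assert (V1 := Vs s ltac:(lra) ltac:(rewrite hst; lra)). rewrite hst in U1, V1.
    assert (O1 := Os (s - t) ltac:(lra)).
    assert (E1 : Rabs (e s i) <= Rabs (e t i) + (s - t) * (sigma t i * f) + 2 * eps * (s - t)).
    { unfold sigma. fold f. rewrite <- O1.
      replace (e s i) with ((e t i + (s - t) * f)
        + ((u s i - u t i - (s - t) * production S (u t) i)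
           - (v s i - v t i - (s - t) * production S (v t) i))) by (unfold e, f; ring).
      apply Rle_trans with (1 := Rabs_triang _ _).
      assert (h := Rabs_minus_le (u s i - u t i - (s - t) * production S (u t) i)
        (v s i - v t i - (s - t) * production S (v t) i)).
      lra. }
    apply (Rmult_le_compat_l (INR i)) in E1; [| lra].
    assert (E2 : INR i * (2 * eps * (s - t)) = eta / 2 * (s - t)) by (unfold eps; field; lra).
    unfold head in *. subst i. rewrite !tech5. fold f. lra.
Qed.

(** Gronwall's argument without integrals: a bound C exp(lam t) on the first moment
of u - v, inserted in the differential inequality, improves to C/2 exp(lam t)
when lam is twice the growth rate; iterating gives 0. *)
Lemma uniqueness : forall i t, (1 <= i)%nat -> 0 <= t <= T -> u t i = v t i.
Proof.
  destruct (path_bounded g T u HT Hg (fun t Ht => proj2 (Hu t Ht)) Cu) as [Bu HBu].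
  destruct (path_bounded g T v HT Hg (fun t Ht => proj2 (Hv t Ht)) Cv) as [Bv HBv].
  assert (Md : forall t, 0 <= t <= T -> has_moment g (e t)).
  { intros t Ht. apply moment_minus; [exact Hg | apply Hu, Ht | apply Hv, Ht]. }
  assert (Id : forall t, 0 <= t <= T -> has_moment INR (e t) /\ moment INR (e t) <= moment g (e t)).
  { intros t Ht. apply moment_le_weight; [apply INR_nonneg | exact HgI | now apply Md]. }
  assert (Bd : forall t, 0 <= t <= T -> moment g (e t) <= Bu + Bv).
  { intros t Ht. destruct (moment_minus g (u t) (v t) Hg (proj2 (Hu t Ht)) (proj2 (Hv t Ht))) as [_ h].
    specialize (HBu t Ht). specialize (HBv t Ht). unfold e. lra. }
  set (B := Bu + Bv) in *.
  assert (HB : 0 <= B).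
  { apply Rle_trans with (2 := Bd 0 ltac:(lra)). apply moment_nonneg; [exact Hg | apply Md; lra]. }
  set (lam := 2 * K * B). assert (Hlam : 0 <= lam) by (unfold lam; nra).
  assert (Htails : forall eps, 0 < eps -> exists n, forall t, 0 <= t <= T ->
     moment (beyond n g) (e t) <= eps).
  { intros eps He.
    destruct (path_uniform_tails g T u HT Hg (fun t Ht => proj2 (Hu t Ht)) Cu (eps / 2) ltac:(lra)) as [n1 Hn1].
    destruct (path_uniform_tails g T v HT Hg (fun t Ht => proj2 (Hv t Ht)) Cv (eps / 2) ltac:(lra)) as [n2 Hn2].
    exists (Nat.max n1 n2). intros t Ht.
    specialize (Hn1 (Nat.max n1 n2) t ltac:(lia) Ht). specialize (Hn2 (Nat.max n1 n2) t ltac:(lia) Ht).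
    destruct (moment_minus (beyond (Nat.max n1 n2) g) (u t) (v t)) as [_ h];
      [now apply beyond_nonneg | now apply moment_beyond; [| apply Hu] | now apply moment_beyond; [| apply Hv] |].
    unfold e. lra. }
  assert (head_0 : forall n, head n 0 = 0).
  { intros n. unfold head. apply sum_eq_R0. intros i _. destruct i as [| i]; [simpl; ring |].
    unfold e. rewrite H0, Rminus_diag, Rabs_R0 by lia. ring. }
  assert (head_cont : forall n s t, 0 <= s <= T -> 0 <= t <= T ->
    head n t <= head n s + (moment g (fun i => u s i - u t i) + moment g (fun i => v s i - v t i))).
  { intros n s t Hs Ht.
    destruct (moment_minus g (u s) (u t) Hg (proj2 (Hu s Hs)) (proj2 (Hu t Ht))) as [h1 _].
    destruct (moment_minus g (v s) (v t) Hg (proj2 (Hv s Hs)) (proj2 (Hv t Ht))) as [h2 _].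
    assert (p1 : sum_f_R0 (fun i => g i * Rabs (u s i - u t i)) n
                 <= moment g (fun i => u s i - u t i)).
    { apply Series_partial_le; [| exact h1].
      intros j. apply Rmult_le_pos; [apply Hg | apply Rabs_pos]. }
    assert (p2 : sum_f_R0 (fun i => g i * Rabs (v s i - v t i)) n
                 <= moment g (fun i => v s i - v t i)).
    { apply Series_partial_le; [| exact h2].
      intros j. apply Rmult_le_pos; [apply Hg | apply Rabs_pos]. }
    apply Rle_trans with (head n s + (sum_f_R0 (fun i => g i * Rabs (u s i - u t i)) n
       + sum_f_R0 (fun i => g i * Rabs (v s i - v t i)) n)); [| lra].
    unfold head. rewrite <- !sum_plus. apply sum_Rle. intros i _.
    rewrite <- Rmult_plus_distr_l.
    assert (ht : Rabs (e t i) <= Rabs (e s i) + (Rabs (u s i - u t i) + Rabs (v s i - v t i))).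
    { replace (e t i) with (e s i + ((v s i - v t i) - (u s i - u t i))) by (unfold e; ring).
      apply Rle_trans with (1 := Rabs_triang _ _).
      assert (h := Rabs_minus_le (v s i - v t i) (u s i - u t i)). lra. }
    apply (Rmult_le_compat_l _ _ _ (pos_INR i)) in ht.
    assert (hx := Rplus_le_le_0_compat _ _ (Rabs_pos (u s i - u t i)) (Rabs_pos (v s i - v t i))).
    assert (hgi := Rmult_le_compat_r _ _ _ hx (HgI i)). lra. }
  assert (halve : forall C, 0 <= C -> (forall t, 0 <= t <= T -> moment INR (e t) <= C * exp (lam * t)) ->
     forall t, 0 <= t <= T -> moment INR (e t) <= C / 2 * exp (lam * t)).
  { intros C HC HE t Ht. apply le_epsilon. intros eps0 He0.
    set (c := (lam / 2 + 1) * T + 1).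
    assert (hc : 0 < c) by (unfold c; nra).
    set (eps := eps0 / c). assert (He : 0 < eps) by (now apply Rdiv_lt_0_compat).
    destruct (Htails eps He) as [n Hn].
    (* C/2 exp(lam t) has derivative at least the main part K B C exp(lam t) of the bound
       for the sum; the linear term absorbs the tail and the error of the expansion. *)
    set (f := fun t => head n t - C / 2 * exp (lam * t) - (lam / 2 + 1) * eps * t).
    assert (Hf : f t <= f 0).
    { revert t Ht. apply nonincreasing_by_dini.
      - intros t eta Ht Heta.
        destruct (Cu t (eta / 2) ltac:(lra) ltac:(lra)) as [d1 [Hd1 U1]].
        destruct (Cv t (eta / 2) ltac:(lra) ltac:(lra)) as [d2 [Hd2 V1]].
        exists (Rmin d1 d2). split; [now apply Rmin_glb_lt |]. intros s Hs Hst.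
        assert (m1 := Rmin_l d1 d2). assert (m2 := Rmin_r d1 d2).
        specialize (U1 s ltac:(lra) ltac:(apply Rabs_def1; lra)).
        specialize (V1 s ltac:(lra) ltac:(apply Rabs_def1; lra)).
        assert (h := head_cont n s t ltac:(lra) ltac:(lra)).
        assert (hx : exp (lam * s) <= exp (lam * t)) by (apply exp_nondecreasing; nra).
        assert (hl : 0 <= (lam / 2 + 1) * eps) by nra.
        unfold f. nra.
      - intros t Ht. destruct (head_derivative n t eps Ht He) as [del [Hd Hs]].
        exists del. split; [exact Hd |]. intros s Hs1 Hs2. specialize (Hs s Hs1 Hs2).
        assert (Ht' : 0 <= t <= T) by lra.
        assert (hD := signed_production_difference (u t) (v t) (sigma t) n
          (proj1 (Hu t Ht')) (proj1 (Hv t Ht')) (proj2 (Hu t Ht')) (proj2 (Hv t Ht'))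
          (fun i => proj1 (orientation_abs _ _)) (fun i => proj2 (orientation_abs _ _))).
        fold (e t) in hD.
        set (D := sum_f_R0 _ n) in *.
        assert (hm1 := HE t Ht'). assert (hm2 := Hn t Ht').
        change (fun i => u t i - v t i) with (e t) in hD.
        assert (p1 := moment_nonneg _ _ INR_nonneg (proj1 (Id t Ht'))).
        assert (p2 : 0 <= moment (beyond n g) (e t)).
        { apply moment_nonneg; [now apply beyond_nonneg |]. apply moment_beyond; [exact Hg | now apply Md]. }
        assert (hs : moment g (u t) + moment g (v t) <= B).
        { specialize (HBu t Ht'). specialize (HBv t Ht'). unfold B. lra. }
        assert (hs0 : 0 <= moment g (u t) + moment g (v t)).
        { apply Rplus_le_le_0_compat; apply moment_nonneg; try exact Hg; [apply Hu | apply Hv]; exact Ht'. }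
        assert (hD2 : D <= lam / 2 * (C * exp (lam * t) + eps)).
        { apply Rle_trans with (1 := hD).
          replace (lam / 2 * (C * exp (lam * t) + eps)) with (K * ((C * exp (lam * t) + eps) * B))
            by (unfold lam; field).
          apply Rmult_le_compat_l; [exact HK0 |]. apply Rmult_le_compat; lra. }
        assert (hexp : exp (lam * t) * (1 + lam * (s - t)) <= exp (lam * s)).
        { replace (lam * s) with (lam * t + lam * (s - t)) by ring. rewrite exp_plus.
          apply Rmult_le_compat_l; [left; apply exp_pos |].
          assert (h0 : 0 <= lam * (s - t)) by nra.
          destruct (Req_dec (lam * (s - t)) 0) as [E | E]; [rewrite E, exp_0; lra |].
          left. apply exp_ineq1. exact E. }
        assert (hx1 := Rmult_le_compat_l (s - t) _ _ ltac:(lra) (Rplus_le_compat_r eps _ _ hD2)).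
        assert (hx2 := Rmult_le_compat_l (C / 2) _ _ ltac:(lra) hexp).
        unfold f. lra. }
    unfold f in Hf. rewrite head_0, !Rmult_0_r, exp_0 in Hf.
    destruct (moment_beyond n INR _ INR_nonneg (proj1 (Id t Ht))) as [h1 h2].
    fold (head n t) in h2.
    destruct (moment_le_weight (beyond n INR) (beyond n g) (e t)) as [_ h3].
    { apply beyond_nonneg, INR_nonneg. }
    { intros j. unfold beyond. destruct Nat.leb; [lra | apply HgI]. }
    { apply moment_beyond; [exact Hg | now apply Md]. }
    specialize (Hn t Ht).
    assert (hfin : (lam / 2 + 1) * eps * t + eps <= eps0).
    { replace eps0 with (eps * c) by (unfold eps; field; lra). unfold c.
      assert (0 <= (lam / 2 + 1) * eps) by nra. nra. }
    lra. }
  assert (iterate : forall m t, 0 <= t <= T -> moment INR (e t) <= B * (/ 2) ^ m * exp (lam * t)).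
  { induction m as [| m IH].
    - intros t Ht. simpl. rewrite Rmult_1_r.
      apply Rle_trans with B; [destruct (Id t Ht) as [_ h]; specialize (Bd t Ht); lra |].
      assert (hx : exp 0 <= exp (lam * t)) by (apply exp_nondecreasing; nra).
      rewrite exp_0 in hx. nra.
    - intros t Ht.
      replace (B * (/ 2) ^ Datatypes.S m) with (B * (/ 2) ^ m / 2) by (simpl; field).
      apply halve; [| exact IH | exact Ht]. apply Rmult_le_pos; [exact HB |]. apply pow_le. lra. }
  intros i t Hi Ht.
  assert (Hzero : moment INR (e t) <= 0).
  { apply le_epsilon. intros eps He. rewrite Rplus_0_l.
    assert (hX : 0 <= B * exp (lam * t)) by (apply Rmult_le_pos; [exact HB | left; apply exp_pos]).
    destruct (pow_lt_1_zero (/ 2) ltac:(rewrite Rabs_pos_eq; lra) (eps / (1 + B * exp (lam * t))))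
      as [m Hm]; [apply Rdiv_lt_0_compat; lra |].
    specialize (Hm m (Nat.le_refl m)). rewrite Rabs_pos_eq in Hm by (apply pow_le; lra).
    apply Rle_trans with (1 := iterate m t Ht).
    apply (Rmult_lt_compat_r (1 + B * exp (lam * t))) in Hm; [| lra].
    replace (eps / (1 + B * exp (lam * t)) * (1 + B * exp (lam * t))) with eps in Hm by (field; lra).
    assert (0 <= (/ 2) ^ m) by (apply pow_le; lra). lra. }
  assert (hp := Series_partial_le _ i (weighted_nonneg INR (e t) INR_nonneg) (proj1 (Id t Ht))).
  fold (moment INR (e t)) in hp.
  destruct i as [| i]; [lia |]. rewrite tech5 in hp.
  assert (hs : 0 <= sum_f_R0 (fun j => INR j * Rabs (e t j)) i).
  { apply cond_pos_sum. apply weighted_nonneg, INR_nonneg. }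
  assert (hi : 1 <= INR (Datatypes.S i)) by (apply INR_ge_1; lia).
  assert (ha := Rabs_pos (e t (Datatypes.S i))).
  assert (hz : Rabs (e t (Datatypes.S i)) = 0) by nra.
  destruct (Req_dec (e t (Datatypes.S i)) 0) as [E | E]; [unfold e in E; lra |].
  apply Rabs_pos_lt in E. lra.
Qed.
End Contraction.

(** * Coagulation with collisional breakage as a collision system *)

Lemma sum_f_R0_from_1 (x : nat -> R) (n : nat) :
  x 0%nat = 0 -> sum_f_R0 x n = sum_n_m x 1 n.
Proof.
  intros H. rewrite <- sum_n_Reals. unfold sum_n. rewrite sum_Sn_m by lia.
  rewrite H. exact (Rplus_0_l _).
Qed.

Lemma sum_n_m_eq (x z : nat -> R) (m n : nat) :
  (forall k, (m <= k <= n)%nat -> x k = z k) -> sum_n_m x m n = sum_n_m z m n.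
Proof. apply sum_n_m_ext_loc. Qed.

Lemma sum_n_m_eq_0 (x : nat -> R) (m n : nat) :
  (forall k, (m <= k <= n)%nat -> x k = 0) -> sum_n_m x m n = 0.
Proof.
  intros H. rewrite (sum_n_m_eq x (fun _ => 0) m n H).
  apply (sum_n_m_const_zero (G := R_AbelianMonoid)).
Qed.

Lemma diag_interior (t : nat -> nat -> R) (m : nat) :
  (forall k, t 0%nat k = 0) -> (forall j, t j 0%nat = 0) ->
  diag t m = sum_n_m (fun k => t (m - k)%nat k) 1 (m - 1).
Proof.
  intros H1 H2. unfold diag. destruct m as [| m].
  - simpl. rewrite sum_n_m_zero by lia. apply H1.
  - rewrite tech5, Nat.sub_diag, H1, Rplus_0_r. replace (S m - 1)%nat with m by lia.
    apply sum_f_R0_from_1. apply H2.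
Qed.

Section Model.
Context (A alpha0 : R) (a p : nat -> nat -> R) (N : nat -> nat -> nat -> R)
    (ha : forall i j, (1 <= i)%nat -> (1 <= j)%nat ->
       0 <= a i j /\ a i j = a j i /\ a i j <= A * (INR i + INR j))
    (hp : forall i j, (1 <= i)%nat -> (1 <= j)%nat ->
       0 <= p i j /\ p i j = p j i /\ p i j <= 1)
    (hN : forall i j s, (1 <= i)%nat -> (1 <= j)%nat ->
       (1 <= s <= i + j - 1)%nat -> N i j s = N j i s /\ 0 <= N i j s)
    (hNmass : forall i j, (1 <= i)%nat -> (1 <= j)%nat ->
       sum_n_m (fun s => INR s * N i j s) 1 (i + j - 1) = INR i + INR j)
    (hNbound : forall i j s, (1 <= i)%nat -> (1 <= j)%nat ->
       (1 <= s <= i + j - 1)%nat -> N i j s <= alpha0).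

Definition collision_rate (j k : nat) : R :=
  match j, k with 0%nat, _ | _, 0%nat => 0 | _, _ => a j k end.

(** The two parts of the outcome: one cluster of size j + k with probability p, the
fragments otherwise. *)
Definition merged (i j k : nat) : R := if Nat.eqb (j + k) i then p j k else 0.

Definition shattered (i j k : nat) : R :=
  if Nat.ltb i (j + k) then (1 - p j k) * N j k i else 0.

(** Outcomes are set to 0 when one size is 0, where the data are arbitrary. *)
Definition collision_yield (i j k : nat) : R :=
  match i, j, k with
  | 0%nat, _, _ | _, 0%nat, _ | _, _, 0%nat => 0
  | _, _, _ => merged i j k + shattered i j k
  end.

Lemma collision_rate_pos (j k : nat) :
  (1 <= j)%nat -> (1 <= k)%nat -> collision_rate j k = a j k.
Proof. destruct j, k; try lia. reflexivity. Qed.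

Lemma collision_rate_r0 (j : nat) : collision_rate j 0 = 0.
Proof. destruct j; reflexivity. Qed.

Lemma collision_yield_pos (i j k : nat) : (1 <= i)%nat -> (1 <= j)%nat -> (1 <= k)%nat ->
  collision_yield i j k = merged i j k + shattered i j k.
Proof. destruct i, j, k; try lia. reflexivity. Qed.

Lemma collision_yield_cases (i j k : nat) :
  collision_yield i j k = 0 \/
  ((1 <= i)%nat /\ (1 <= j)%nat /\ (1 <= k)%nat /\
   collision_yield i j k = merged i j k + shattered i j k).
Proof.
  destruct i; [now left |]. destruct j; [now left |]. destruct k; [now left |].
  right. repeat split; lia || reflexivity.
Qed.

Lemma merged_bounds (i j k : nat) : (1 <= j)%nat -> (1 <= k)%nat -> 0 <= merged i j k <= 1.
Proof.
  intros Hj Hk. destruct (hp j k Hj Hk) as [h1 [_ h2]]. unfold merged. destruct Nat.eqb; lra.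
Qed.

Lemma alpha0_nonneg : 0 <= alpha0.
Proof.
  destruct (hN 1 1 1) as [_ h]; [lia | lia | lia |]. specialize (hNbound 1 1 1).
  apply Rle_trans with (1 := h). apply hNbound; lia.
Qed.

Lemma shattered_bounds (i j k : nat) : (1 <= i)%nat -> (1 <= j)%nat -> (1 <= k)%nat ->
  0 <= shattered i j k <= alpha0.
Proof.
  intros Hi Hj Hk. assert (h0 := alpha0_nonneg). destruct (hp j k Hj Hk) as [h1 [_ h2]].
  unfold shattered. destruct (Nat.ltb_spec i (j + k)); [| lra].
  destruct (hN j k i Hj Hk ltac:(lia)) as [_ h3].
  assert (h4 := hNbound j k i Hj Hk ltac:(lia)). nra.
Qed.

Lemma rate_bound_nonneg : 0 <= A.
Proof. destruct (ha 1 1) as [h1 [_ h2]]; [lia | lia |]. simpl in h2. lra. Qed.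

Definition breakage_collisions : collisions A (1 + alpha0).
Proof.
  refine (Collisions A (1 + alpha0) collision_rate collision_yield _ _ _ _ _ _ _ _ _).
  - intros [| j] [| k]; simpl; try lra. apply ha; lia.
  - intros [| j] [| k]; simpl; try reflexivity. apply ha; lia.
  - intros j k. assert (hA := rate_bound_nonneg).
    assert (hjk : 0 <= A * (INR j + INR k)).
    { assert (h1 := pos_INR j). assert (h2 := pos_INR k). nra. }
    destruct j as [| j]; [exact hjk |]. destruct k as [| k]; [exact hjk |].
    apply ha; lia.
  - reflexivity.
  - intros i j k. destruct (collision_yield_cases i j k) as [-> | [Hi [Hj [Hk ->]]]]; [lra |].
    assert (h1 := merged_bounds i j k Hj Hk). assert (h2 := shattered_bounds i j k Hi Hj Hk). lra.
  - intros i [| j] [| k]; destruct i as [| i]; try reflexivity.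
    unfold collision_yield, merged, shattered. rewrite (Nat.add_comm (S k) (S j)).
    destruct (hp (S j) (S k)) as [_ [e _]]; [lia | lia |]. rewrite <- e.
    destruct (Nat.ltb_spec (S i) (S j + S k)); [| reflexivity].
    destruct (hN (S j) (S k) (S i)) as [e' _]; [lia | lia | lia |]. now rewrite e'.
  - intros i j k. assert (h0 := alpha0_nonneg).
    destruct (collision_yield_cases i j k) as [-> | [Hi [Hj [Hk ->]]]]; [lra |].
    assert (h1 := merged_bounds i j k Hj Hk). assert (h2 := shattered_bounds i j k Hi Hj Hk). lra.
  - intros i j k Hijk.
    destruct (collision_yield_cases i j k) as [-> | [Hi [Hj [Hk ->]]]]; [reflexivity |].
    unfold merged, shattered.
    destruct (Nat.eqb_spec (j + k) i); [lia |]. destruct (Nat.ltb_spec i (j + k)); [lia | ring].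
  - intros j k Hj Hk.
    destruct (j + k)%nat as [| m] eqn:E; [lia |]. rewrite tech5.
    rewrite collision_yield_pos by lia. unfold merged at 1, shattered at 1.
    rewrite E, Nat.eqb_refl, Nat.ltb_irrefl.
    rewrite (sum_eq _ (fun i => (1 - p j k) * (INR i * (if Nat.leb 1 i then N j k i else 0)))).
    + rewrite sum_scal_l, sum_f_R0_from_1 by (simpl; ring).
      rewrite (sum_n_m_eq _ (fun s => INR s * N j k s)).
      * assert (h := hNmass j k Hj Hk). replace (j + k - 1)%nat with m in h by lia.
        rewrite h. rewrite <- E, plus_INR. ring.
      * intros i Hi. now rewrite (proj2 (Nat.leb_le 1 i)) by lia.
    + intros i Hi. destruct i as [| i]; [simpl; ring |].
      rewrite collision_yield_pos by lia. unfold merged, shattered.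
      destruct (Nat.eqb_spec (j + k) (S i)); [lia |].
      destruct (Nat.ltb_spec (S i) (j + k)); [| lia]. simpl Nat.leb. cbv iota. ring.
Defined.

Lemma collision_rate_bounds (j k : nat) : 0 <= collision_rate j k <= 2 * A * (INR j * INR k).
Proof.
  split; [apply (rate_nonneg _ _ breakage_collisions) | apply (rate_le_product breakage_collisions)].
Qed.

Lemma reaction_summable (y : nat -> R) (c : nat -> nat -> R) (C : R) :
  has_moment INR y -> 0 <= C ->
  (forall j k, (1 <= j)%nat -> (1 <= k)%nat -> Rabs (c j k) <= C) ->
  double_summable (fun j k => collision_rate j k * c j k * (y j * y k)).
Proof.
  intros Hy HC Hc.
  apply (double_series_dominated _ (2 * A * C) (fun j => INR j * Rabs (y j))
    (fun k => INR k * Rabs (y k))); try apply weighted_nonneg, INR_nonneg; try exact Hy.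
  intros j k. rewrite !Rabs_mult.
  assert (hj := pos_INR j). assert (hk := pos_INR k). assert (hA := rate_bound_nonneg).
  assert (hyj := Rabs_pos (y j)). assert (hyk := Rabs_pos (y k)).
  assert (hyy := Rmult_le_pos _ _ hyj hyk).
  replace (2 * A * C * (INR j * Rabs (y j) * (INR k * Rabs (y k))))
    with (2 * A * (INR j * INR k) * C * (Rabs (y j) * Rabs (y k))) by ring.
  apply Rmult_le_compat_r; [exact hyy |].
  destruct (collision_rate_bounds j k) as [h1 h2]. rewrite (Rabs_pos_eq _ h1).
  destruct j as [| j]; [simpl; lra |]. destruct k as [| k]; [rewrite collision_rate_r0; simpl; lra |].
  apply Rmult_le_compat; [exact h1 | apply Rabs_pos | exact h2 | apply Hc; lia].
Qed.

(** The gain is split into coagulation, which lives on the antidiagonal i only, and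
breakage, which lives on those beyond i; the two loss terms are exchanged by
swapping j and k, and together give the full loss once the factor 1/2 is used. *)
Lemma production_eq_cb_rhs (y : nat -> R) (i : nat) :
  has_moment INR y -> (1 <= i)%nat ->
  summable_from 1 (loss_term a y i) /\
  summable_from (i + 1) (breakage_term a p N y i) /\
  production breakage_collisions y i = cb_rhs a p N y i.
Proof.
  intros Hy Hi.
  set (t1 := fun j k => collision_rate j k * merged i j k * (y j * y k)).
  set (t2 := fun j k => collision_rate j k * shattered i j k * (y j * y k)).
  set (t3 := fun j k => collision_rate j k * kron i j * (y j * y k)).
  assert (S1 : double_summable t1).
  { apply reaction_summable with 1; [exact Hy | lra |]. intros j k Hj Hk.
    assert (h := merged_bounds i j k Hj Hk). apply Rabs_le. lra. }
  assert (S2 : double_summable t2).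
  { apply reaction_summable with alpha0; [exact Hy | apply alpha0_nonneg |]. intros j k Hj Hk.
    assert (h := shattered_bounds i j k Hi Hj Hk). apply Rabs_le. lra. }
  assert (S3 : double_summable t3).
  { apply reaction_summable with 1; [exact Hy | lra |]. intros j k _ _.
    assert (h := kron_bounds i j). apply Rabs_le. lra. }
  assert (S3' := double_summable_swap _ S3).
  assert (E : production breakage_collisions y i
    = / 2 * double_series t1 + / 2 * double_series t2 - double_series t3).
  { transitivity (double_series (fun j k => (/ 2 * t1 j k + / 2 * t2 j k)
       + (- / 2 * t3 j k + - / 2 * t3 k j))).
    - apply double_series_ext. intros j k. unfold net, t1, t2, t3. simpl rate. simpl yield.
      destruct j as [| j]; [simpl; rewrite collision_rate_r0; ring |].
      destruct k as [| k]; [simpl; ring |].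
      rewrite collision_yield_pos by lia.
      replace (collision_rate (S k) (S j)) with (collision_rate (S j) (S k))
        by apply (rate_sym _ _ breakage_collisions).
      ring.
    - rewrite !double_series_plus; repeat apply double_summable_plus;
        try apply double_summable_scal; try assumption.
      rewrite (double_series_scal _ t1), (double_series_scal _ t2), (double_series_scal _ t3),
        (double_series_scal _ (fun j k => t3 k j)), (double_series_swap t3). field. }
  assert (D1 : forall m, diag t1 m = coag_gain a p y i * kron m i).
  { intros m. rewrite diag_interior.
    2:{ intros k. unfold t1. simpl. ring. }
    2:{ intros j. unfold t1. rewrite collision_rate_r0. ring. }
    unfold kron. destruct (Nat.eqb_spec m i) as [-> | Hm].
    - rewrite Rmult_1_r. apply sum_n_m_eq. intros k Hk. unfold t1, merged.
      replace (i - k + k)%nat with i by lia. rewrite Nat.eqb_refl.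
      rewrite collision_rate_pos by lia.
      destruct (ha k (i - k)) as [_ [e1 _]]; [lia | lia |].
      destruct (hp k (i - k)) as [_ [e2 _]]; [lia | lia |]. rewrite e1, e2. ring.
    - rewrite Rmult_0_r. apply sum_n_m_eq_0. intros k Hk. unfold t1, merged.
        destruct (Nat.eqb_spec (m - k + k) i); [lia | ring]. }
  assert (D2 : forall m, diag t2 m = if Nat.ltb i m then breakage_term a p N y i m else 0).
  { intros m. rewrite diag_interior.
    2:{ intros k. unfold t2. simpl. ring. }
    2:{ intros j. unfold t2. rewrite collision_rate_r0. ring. }
    destruct (Nat.ltb_spec i m) as [Hm | Hm].
    - apply sum_n_m_eq. intros k Hk. unfold t2, shattered.
      replace (m - k + k)%nat with m by lia. rewrite (proj2 (Nat.ltb_lt i m) Hm).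
      rewrite collision_rate_pos by lia. ring.
    - apply sum_n_m_eq_0. intros k Hk. unfold t2, shattered.
        replace (m - k + k)%nat with m by lia. rewrite (proj2 (Nat.ltb_ge i m) Hm). ring. }
  assert (D3 : forall m, diag t3 m
     = if Nat.leb i m then collision_rate i (m - i) * (y i * y (m - i)%nat) else 0).
  { intros m. rewrite <- diag_swap.
    rewrite <- (sum_kron (fun k => collision_rate k (m - k) * (y k * y (m - k)%nat)) i m).
    apply sum_eq. intros k _. unfold t3, kron. rewrite (Nat.eqb_sym i k). ring. }
  assert (X2 := double_summable_series _ S2). assert (X3 := double_summable_series _ S3).
  assert (F1 : double_series t1 = coag_gain a p y i).
  { unfold double_series. rewrite (Series_ext _ _ D1).
    exact (proj2 (Series_kron (fun _ => coag_gain a p y i) i)). }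
  assert (shift2 : forall n, diag t2 (i + 1 + n) = breakage_term a p N y i (i + 1 + n)).
  { intros n. rewrite D2. now rewrite (proj2 (Nat.ltb_lt _ _)) by lia. }
  assert (F2 : double_series t2 = sum_from (i + 1) (breakage_term a p N y i)).
  { unfold double_series. rewrite (Series_incr_n_aux _ (i + 1)).
    - now apply Series_ext.
    - intros k Hk. rewrite D2. now rewrite (proj2 (Nat.ltb_ge _ _)) by lia. }
  assert (shift3 : forall n, diag t3 (i + 1 + n) = loss_term a y i (1 + n)).
  { intros n. rewrite D3, (proj2 (Nat.leb_le _ _)) by lia.
    replace (i + 1 + n - i)%nat with (1 + n)%nat by lia.
    rewrite collision_rate_pos by lia. unfold loss_term. ring. }
  assert (F3 : double_series t3 = sum_from 1 (loss_term a y i)).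
  { unfold double_series. rewrite (Series_incr_n_aux _ (i + 1)).
    - now apply Series_ext.
    - intros k Hk. rewrite D3. destruct (Nat.leb_spec i k); [| reflexivity].
      replace (k - i)%nat with 0%nat by lia. rewrite collision_rate_r0. ring. }
  split; [| split].
  - apply ex_series_ext with (1 := shift3). now apply (ex_series_incr_n (diag t3)).
  - apply ex_series_ext with (1 := shift2). now apply (ex_series_incr_n (diag t2)).
  - rewrite E, F1, F2, F3. unfold cb_rhs. ring.
Qed.
End Model.

(** * The power weights and the classical formulation *)

(** Written so as to vanish at 0, where [Rpower] does not. *)
Definition power_weight (beta : R) (j : nat) : R := INR j * Rpower (INR j) (beta - 1).

Lemma power_weight_pos (beta : R) (j : nat) :
  (1 <= j)%nat -> power_weight beta j = Rpower (INR j) beta.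
Proof.
  intros Hj. assert (h := INR_ge_1 j Hj). unfold power_weight.
  rewrite <- (Rpower_1 (INR j)) at 1 by lra. rewrite <- Rpower_plus. f_equal. ring.
Qed.

Lemma Rpower_pos (x z : R) : 0 < Rpower x z.
Proof. apply exp_pos. Qed.

Lemma power_weight_growth (beta : R) : 1 <= beta <= 2 -> growth_weight (power_weight beta).
Proof.
  intros Hb. unfold power_weight.
  assert (ge1 : forall j, (1 <= j)%nat -> 1 <= Rpower (INR j) (beta - 1)).
  { intros j Hj. assert (h := INR_ge_1 j Hj). rewrite <- (Rpower_O (INR j)) at 1 by lra.
    apply Rle_Rpower; lra. }
  split; [| split; [| split; [| split]]].
  - intros j. apply Rmult_le_pos; [apply pos_INR | left; apply Rpower_pos].
  - simpl. ring.
  - intros [| j]; [simpl; lra |]. specialize (ge1 (S j) ltac:(lia)).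
    assert (h := pos_INR (S j)). nra.
  - intros i j Hij. assert (hi := INR_ge_1 i ltac:(lia)).
    assert (hij : INR i <= INR j) by (apply le_INR; lia).
    assert (h : Rpower (INR i) (beta - 1) <= Rpower (INR j) (beta - 1)) by (apply Rle_Rpower_l; lra).
    assert (0 <= INR i * INR j) by nra. nra.
  - intros i j Hij. assert (hi := INR_ge_1 i ltac:(lia)).
    assert (hij : INR i <= INR j) by (apply le_INR; lia).
    assert (h : Rpower (INR i) (2 - beta) <= Rpower (INR j) (2 - beta)) by (apply Rle_Rpower_l; lra).
    assert (split : forall k, 1 <= k -> k = Rpower k (beta - 1) * Rpower k (2 - beta)).
    { intros k Hk. rewrite <- Rpower_plus. replace (beta - 1 + (2 - beta)) with 1 by ring.
      rewrite Rpower_1; lra. }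
    assert (ei := split (INR i) hi). assert (ej := split (INR j) ltac:(lra)).
    assert (pi := Rpower_pos (INR i) (beta - 1)). assert (pj := Rpower_pos (INR j) (beta - 1)).
    assert (key : Rpower (INR j) (beta - 1) * INR i <= Rpower (INR i) (beta - 1) * INR j).
    { rewrite ei at 1. rewrite ej at 2.
      rewrite (Rmult_comm (Rpower (INR j) (beta - 1))), !Rmult_assoc.
      apply Rmult_le_compat_l; [lra |]. rewrite Rmult_comm. apply Rmult_le_compat_l; lra. }
    assert (0 <= INR i * INR j) by nra.
    assert (k2 := Rmult_le_compat_l (INR i * INR j) _ _ ltac:(assumption) key). lra.
Qed.

Lemma in_l1_moment (beta : R) (y : nat -> R) : in_l1 beta y <-> has_moment (power_weight beta) y.
Proof.
  unfold in_l1, summable_from, has_moment.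
  rewrite (ex_series_incr_1 (fun j => power_weight beta j * Rabs (y j))).
  split; apply ex_series_ext; intros n; rewrite power_weight_pos by lia; reflexivity.
Qed.

Lemma norm_l1_moment (beta : R) (y : nat -> R) : norm_l1 beta y = moment (power_weight beta) y.
Proof.
  unfold norm_l1, sum_from, moment.
  rewrite (Series_incr_1_aux (fun j => power_weight beta j * Rabs (y j)))
    by (unfold power_weight; simpl; ring).
  apply Series_ext. intros n. rewrite power_weight_pos by lia. reflexivity.
Qed.

Lemma filterlim_segment (T t l : R) (f : R -> R) :
  filterlim f (within (segment T) (locally t)) (locally l) <->
  forall eps, 0 < eps -> exists del, 0 < del /\
    forall s, 0 <= s <= T -> Rabs (s - t) < del -> Rabs (f s - l) < eps.
Proof.
  rewrite filterlim_locally. split.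
  - intros H eps He. destruct (H (mkposreal eps He)) as [del Hd].
    exists del. split; [apply cond_pos |]. intros s Hs Hst. now apply (Hd s).
  - intros H eps. destruct (H eps (cond_pos eps)) as [del [Hd Hs]].
    exists (mkposreal del Hd). intros s Hst HsT. now apply Hs.
Qed.

Lemma D_in_segment (T t : R) (f d : R -> R) :
  D_in f d (segment T) t <->
  forall eps, 0 < eps -> exists del, 0 < del /\ forall s, 0 <= s <= T -> Rabs (s - t) < del ->
    Rabs (f s - f t - (s - t) * d t) <= eps * Rabs (s - t).
Proof.
  assert (E : forall s, s <> t ->
    Rabs (f s - f t - (s - t) * d t) = Rabs ((f s - f t) / (s - t) - d t) * Rabs (s - t)).
  { intros s Hs. rewrite <- Rabs_mult. f_equal. field. lra. }
  split.
  - intros H eps He. destruct (H eps He) as [del [Hd Hs]].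
    exists del. split; [exact Hd |]. intros s HsT Hst.
    destruct (Req_dec s t) as [-> | Hne].
    + rewrite !Rminus_diag, Rmult_0_l, Rminus_0_r, Rabs_R0. lra.
    + rewrite E by exact Hne. apply Rmult_le_compat_r; [apply Rabs_pos |].
      left. apply Hs. split; [split; [exact HsT | auto] | exact Hst].
  - intros H eps He. destruct (H (eps / 2) ltac:(lra)) as [del [Hd Hs]].
    exists del. split; [exact Hd |]. intros s [[HsT Hne] Hst].
    change (Rabs ((f s - f t) / (s - t) - d t) < eps).
    specialize (Hs s HsT Hst). rewrite E in Hs by auto.
    assert (hp : 0 < Rabs (s - t)) by (apply Rabs_pos_lt; lra).
    apply Rmult_le_reg_r in Hs; [lra | exact hp].
Qed.

(** Nothing is known about a solution at the index 0; this makes it nonnegative there. *)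
Definition vanish_at_0 (y : nat -> R) (i : nat) : R := match i with 0%nat => 0 | _ => y i end.

Lemma moment_congr (g y z : nat -> R) :
  g 0%nat = 0 -> (forall i, (1 <= i)%nat -> y i = z i) ->
  moment g y = moment g z /\ (has_moment g y -> has_moment g z).
Proof.
  intros g0 H.
  assert (E : forall j, g j * Rabs (y j) = g j * Rabs (z j)).
  { intros [| j]; [rewrite g0; ring | now rewrite H by lia]. }
  split; [now apply Series_ext | now apply ex_series_ext].
Qed.

Lemma production_congr {A alpha : R} (S : collisions A alpha) (y z : nat -> R) (i : nat) :
  (forall j, (1 <= j)%nat -> y j = z j) -> production S y i = production S z i.
Proof.
  intros H. apply double_series_ext. intros j k. unfold net.
  destruct j as [| j]; [rewrite rate_0; ring |].
  destruct k as [| k]; [rewrite (rate_r0 S); ring |].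
  now rewrite !H by lia.
Qed.

(** The place where 1 + gamma <= beta enters: k (j^gamma + k^gamma) <= 2 j k^beta. *)
Lemma power_kernel_bound (B gamma beta : R) (j k : nat) :
  0 < B -> 0 <= gamma <= 1 -> 1 + gamma <= beta -> (1 <= j)%nat -> (1 <= k)%nat ->
  INR k * (B * (Rpower (INR j) gamma + Rpower (INR k) gamma))
  <= 2 * B * (INR j * power_weight beta k).
Proof.
  intros HB Hg Hb Hj Hk. assert (hj := INR_ge_1 j Hj). assert (hk := INR_ge_1 k Hk).
  unfold power_weight.
  assert (e1 : Rpower (INR j) gamma <= INR j).
  { rewrite <- (Rpower_1 (INR j)) at 2 by lra. apply Rle_Rpower; lra. }
  assert (e2 : Rpower (INR k) gamma <= Rpower (INR k) (beta - 1)) by (apply Rle_Rpower; lra).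
  assert (e3 : 1 <= Rpower (INR k) gamma).
  { rewrite <- (Rpower_O (INR k)) by lra. apply Rle_Rpower; lra. }
  set (X := Rpower (INR j) gamma) in *. set (Y := Rpower (INR k) gamma) in *.
  set (Z := Rpower (INR k) (beta - 1)) in *.
  assert (X + Y <= 2 * (INR j * Z)) by nra.
  assert (0 <= INR k * B) by nra. nra.
Qed.

Theorem theorem2p1 (T beta A alpha0 : R) (a p : nat -> nat -> R)
    (N : nat -> nat -> nat -> R) (w0 : nat -> R)
    (hT : 0 < T) (hbeta : 1 < beta <= 2) (hA : 0 < A)
    (ha : forall i j, (1 <= i)%nat -> (1 <= j)%nat ->
       0 <= a i j /\ a i j = a j i /\ a i j <= A * (INR i + INR j))
    (hp : forall i j, (1 <= i)%nat -> (1 <= j)%nat ->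
       0 <= p i j /\ p i j = p j i /\ p i j <= 1)
    (hN : forall i j s, (1 <= i)%nat -> (1 <= j)%nat ->
       (1 <= s <= i + j - 1)%nat -> N i j s = N j i s /\ 0 <= N i j s)
    (hNmass : forall i j, (1 <= i)%nat -> (1 <= j)%nat ->
       sum_n_m (fun s => INR s * N i j s) 1 (i + j - 1) = INR i + INR j)
    (hNbound : forall i j s, (1 <= i)%nat -> (1 <= j)%nat ->
       (1 <= s <= i + j - 1)%nat -> N i j s <= alpha0)
    (hw0_pos : forall i, (1 <= i)%nat -> 0 <= w0 i)
    (hw0_sum : summable_from 1 (fun i => Rpower (INR i) beta * w0 i)) :
  (exists w : R -> nat -> R,
     classical_solution beta T a p N w0 w /\ mass_conserving T w) /\
  (forall B gamma : R, 0 < B -> 0 <= gamma <= 1 -> 1 < 1 + gamma <= beta ->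
     (forall i j, (1 <= i)%nat -> (1 <= j)%nat ->
        0 <= a i j /\ a i j = a j i /\
        a i j <= B * (Rpower (INR i) gamma + Rpower (INR j) gamma)) ->
     forall u v : R -> nat -> R,
       classical_solution beta T a p N w0 u ->
       classical_solution beta T a p N w0 v ->
       forall i t, (1 <= i)%nat -> 0 <= t <= T -> u t i = v t i).
Proof.
  set (S := breakage_collisions A alpha0 a p N ha hp hN hNmass hNbound).
  assert (HS : forall y i, has_moment INR y -> (1 <= i)%nat ->
    summable_from 1 (loss_term a y i) /\ summable_from (i + 1) (breakage_term a p N y i) /\
    production S y i = cb_rhs a p N y i).
  { intros y i. apply production_eq_cb_rhs. }
  assert (Hrate : forall j k, (1 <= j)%nat -> (1 <= k)%nat -> rate S j k = a j k).
  { intros j k. apply collision_rate_pos. }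
  clearbody S.
  set (g := power_weight beta).
  assert (Hg : growth_weight g) by (apply power_weight_growth; lra).
  assert (gn := proj1 Hg). assert (g0 := proj1 (proj2 Hg)).
  assert (gI := proj1 (proj2 (proj2 Hg))).
  assert (toI : forall y, has_moment g y -> has_moment INR y).
  { intros y h. exact (proj1 (moment_le_weight INR g y INR_nonneg gI h)). }
  split.
  - set (y := vanish_at_0 w0).
    assert (Hy : nonnegative y).
    { intros [| i]; simpl; [lra | apply hw0_pos; lia]. }
    assert (Hgy : has_moment g y).
    { apply in_l1_moment. apply ex_series_ext with (2 := hw0_sum).
      intros n. unfold y. simpl. rewrite Rabs_pos_eq; [reflexivity | apply hw0_pos; lia]. }
    destruct (existence S g y T Hg Hy Hgy ltac:(lra)) as [w [W0 [Wm [Wc Ws]]]].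
    exists w. split.
    + split; [split; [split |] |split].
      * intros t Ht. apply in_l1_moment. now apply Wm.
      * intros t Ht. apply filterlim_segment. intros eps He.
        destruct (Wc t eps Ht He) as [del [Hd Hs]]. exists del. split; [exact Hd |].
        intros s HsT Hst. specialize (Hs s HsT Hst). rewrite norm_l1_moment, Rminus_0_r.
        rewrite Rabs_pos_eq; [exact Hs |]. apply moment_nonneg; [exact gn |].
        apply moment_minus; [exact gn | now apply Wm | now apply Wm].
      * intros i t _ Ht. now apply Wm.
      * exists (fun t i => cb_rhs a p N (w t) i). intros i Hi. split.
        -- intros t Ht. apply filterlim_segment. intros eps He.
           destruct (Wm t Ht) as [_ [Mt It]]. set (M := moment INR y) in *.
           set (C := 2 * A * (1 + alpha0 + 2) * M).
           assert (hC : 0 <= C).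
           { assert (h := alpha_nonneg S).
             assert (hM : 0 <= M) by (apply moment_nonneg; [apply INR_nonneg | now apply toI]).
             unfold C. apply Rmult_le_pos; [nra | exact hM]. }
           destruct (Wc t (eps / (1 + C)) Ht ltac:(apply Rdiv_lt_0_compat; lra)) as [del [Hd Hs]].
           exists del. split; [exact Hd |]. intros s HsT Hst. specialize (Hs s HsT Hst).
           destruct (Wm s HsT) as [_ [Ms Is]].
           destruct (HS (w s) i (toI _ Ms) Hi) as [_ [_ <-]].
           destruct (HS (w t) i (toI _ Mt) Hi) as [_ [_ <-]].
           destruct (moment_minus g _ _ gn Ms Mt) as [Md _].
           destruct (moment_le_weight INR g _ INR_nonneg gI Md) as [_ hle].
           eapply Rle_lt_trans.
           { apply (production_lipschitz S (w s) (w t) i M (toI _ Ms) (toI _ Mt)); lra. }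
           fold C. apply Rle_lt_trans with ((1 + C) * moment g (fun j => w s j - w t j)).
           { assert (h0 := moment_nonneg _ _ gn Md).
             assert (h1 := Rmult_le_compat_l _ _ _ hC hle). lra. }
           apply (Rmult_lt_compat_l (1 + C)) in Hs; [| lra].
           replace ((1 + C) * (eps / (1 + C))) with eps in Hs by (field; lra). exact Hs.
        -- intros t Ht. destruct (Wm t Ht) as [_ [Mt _]].
           destruct (HS (w t) i (toI _ Mt) Hi) as [L1 [L2 E]].
           split; [| split; [exact L1 | split; [exact L2 | reflexivity]]].
           apply D_in_segment. intros eps He. rewrite <- E. now apply Ws.
      * intros i Hi. rewrite W0. destruct i; [lia | reflexivity].
    + assert (mass : forall t, segment T t ->
        is_series (fun n => INR (1 + n) * w t (1 + n)%nat) (moment INR y)).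
      { intros t Ht. destruct (Wm t Ht) as [Pt [Mt It]].
        assert (Hs := toI _ Mt). unfold has_moment in Hs. rewrite <- It. unfold moment.
        rewrite Series_incr_1_aux by (simpl; ring).
        apply ex_series_incr_1 in Hs. apply Series_correct in Hs.
        apply is_series_ext with (2 := Hs). intros n. now rewrite Rabs_pos_eq by apply Pt. }
      intros t Ht. split; [eexists; now apply mass |].
      unfold M1, sum_from. rewrite (is_series_unique _ _ (mass t Ht)).
      symmetry. apply is_series_unique. apply mass. unfold segment; lra.
  - intros B gamma HB Hgam Hgb HaB u v Hu Hv i t Hi Ht.
    assert (prepare : forall w, classical_solution beta T a p N w0 w ->
      let w' := fun t => vanish_at_0 (w t) in
      (forall t, 0 <= t <= T -> nonnegative (w' t) /\ has_moment g (w' t)) /\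
      path_continuous g T w' /\ solves S T w' /\ (forall i, (1 <= i)%nat -> w' 0 i = w0 i)).
    { intros w [[[W1 W2] W3] [[dw W4] W5]] w'.
      assert (same : forall t i, (1 <= i)%nat -> w' t i = w t i) by (intros t' [| j] Hj; [lia | reflexivity]).
      assert (Wm : forall t, 0 <= t <= T -> has_moment g (w' t)).
      { intros t' Ht'. apply (moment_congr g (w t')); [exact g0 | | now apply in_l1_moment, W1].
        intros j Hj. now rewrite same. }
      split; [| split; [| split]].
      - intros t' Ht'. split; [| now apply Wm].
        intros [| j]; simpl; [lra | apply W3; [lia | exact Ht']].
      - intros t' eps Ht' He.
        destruct (proj1 (filterlim_segment _ _ _ _) (W2 t' Ht') eps He) as [del [Hd Hs]].
        exists del. split; [exact Hd |]. intros s HsT Hst. specialize (Hs s HsT Hst).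
        rewrite norm_l1_moment, Rminus_0_r in Hs.
        rewrite (proj1 (moment_congr g (fun j => w' s j - w' t' j) (fun j => w s j - w t' j) g0
          (fun j Hj => f_equal2 Rminus (same s j Hj) (same t' j Hj)))).
        apply Rle_lt_trans with (1 := Rle_abs _). exact Hs.
      - intros j t' eps Hj Ht' He.
        destruct (W4 j Hj) as [_ W]. destruct (W t' Ht') as [WD [_ [_ WE]]].
        rewrite D_in_segment in WD. destruct (WD eps He) as [del [Hd Hs]].
        exists del. split; [exact Hd |]. intros s HsT Hst. specialize (Hs s HsT Hst).
        rewrite !same by exact Hj. rewrite WE in Hs.
        assert (Mt : has_moment INR (w t')) by now apply toI, in_l1_moment, W1.
        destruct (HS (w t') j Mt Hj) as [_ [_ E]].
        rewrite (production_congr S (w' t') (w t') j (same t')), E. exact Hs.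
      - intros j Hj. rewrite same by exact Hj. now apply W5. }
    destruct (prepare u Hu) as [U1 [U2 [U3 U4]]]. destruct (prepare v Hv) as [V1 [V2 [V3 V4]]].
    assert (HK : forall j k, INR k * rate S j k <= 2 * B * (INR j * g k)).
    { intros j k.
      destruct j as [| j]; [rewrite rate_0; simpl; lra |].
      destruct k as [| k]; [rewrite (rate_r0 S), g0; lra |].
      rewrite Hrate by lia. destruct (HaB (Datatypes.S j) (Datatypes.S k)) as [_ [_ h]]; [lia | lia |].
      apply Rle_trans with (INR (Datatypes.S k) * (B * (Rpower (INR (Datatypes.S j)) gamma
        + Rpower (INR (Datatypes.S k)) gamma))).
      - apply Rmult_le_compat_l; [apply pos_INR | exact h].
      - apply power_kernel_bound; lra || lia. }
    assert (H := uniqueness S g (2 * B) gI HK ltac:(lra) T ltac:(lra) _ _ U1 V1 U2 V2 U3 V3).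
    assert (E := H (fun j Hj => eq_trans (U4 j Hj) (eq_sym (V4 j Hj))) i t Hi Ht).
    destruct i; [lia | exact E].
Qed.
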